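(* Let $\Omega\subset\mathbb{R}^n$ be an open bounded connected set, and assume that $\Omega$ is convex. There exists a constant $c$ such that the overdetermined boundary value problem $$\begin{cases}-\Delta^N_\infty u=1&\text{in }\Omega,\\ u=0&\text{on }\partial\Omega,\\ |\nabla u|=c&\text{on }\partial\Omega\end{cases}$$ admits a solution $u\in C^1(\overline\Omega)$ if and only if $\Omega$ is a stadium-like domain. Moreover, whenever such a solution $u$ exists for a constant $c$, one has $u=\phi^\Omega_N$ and $\rho_\Omega=c$.
   Context: For $\varphi\in C^2$, the normalized infinity Laplacian at points where $\nabla\varphi\ne0$ is $\Delta^N_\infty\varphi:=|\nabla\varphi|^{-2}\langle\nabla^2\varphi\,\nabla\varphi,\nabla\varphi\rangle$. Set $\Delta^+_\infty\varphi(x)=\Delta^-_\infty\varphi(x)=\Delta^N_\infty\varphi(x)$ if $\nabla\varphi(x)\neq0$, while if $\nabla\varphi(x)=0$ set $\Delta^+_\infty\varphi(x)=\lambda_{\max}(\nabla^2\varphi(x))$ and $\Delta^-_\infty\varphi(x)=\lambda_{\min}(\nabla^2\varphi(x))$ (maximum and minimum eigenvalue). For functions $u,v:\Omega\to\mathbb{R}$ and $x\in\Omega$, $u\prec_x v$ means $u(x)=v(x)$ and $u(y)\le v(y)$ for every $y\in\Omega$. An upper semicontinuous function $u$ is a viscosity subsolution of $-\Delta^N_\infty u=1$ in $\Omega$ if for every $x\in\Omega$ and every $\varphi\in C^2(\Omega)$ with $u\prec_x\varphi$ one has $-\Delta^+_\infty\varphi(x)\le1$. A lower semicontinuous function $u$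 is a viscosity supersolution if for every $x\in\Omega$ and every $\varphi\in C^2(\Omega)$ with $\varphi\prec_x u$ one has $-\Delta^-_\infty\varphi(x)\ge1$. A viscosity solution is a continuous function that is both a sub- and a supersolution. A solution $u\in C^1(\overline\Omega)$ of the overdetermined problem is a viscosity solution of the equation in $\Omega$ which vanishes on $\partial\Omega$, is of class $C^1$ up to the boundary ($u$ and $\nabla u$ extend continuously to $\overline\Omega$), and satisfies $|\nabla u|=c$ pointwise on $\partial\Omega$. $d_{\partial\Omega}$ is the distance function to $\partial\Omega$; $\rho_\Omega:=\max_{\overline\Omega}d_{\partial\Omega}$; $\Sigma(\Omega)$ is the set of points of $\Omega$ where $d_{\partial\Omega}$ is not differentiable; the cut locus $\overline\Sigma(\Omega)$ is the closure of $\Sigma(\Omega)$ in $\overline\Omega$; the high ridge is $M(\Omega):=\{x\in\overline\Omega: d_{\partial\Omega}(x)=\rho_\Omega\}$. An open bounded convex subset $\Omega$ of $\mathbb{R}^n$ is a stadium-like domain if $\overline\Sigma(\Omega)=M(\Omega)$. $\phi^\Omega_N(x):=\frac12\big[\rho_\Omega^{2}-(\rho_\Omega-d_{\partial\Omega}(x))^{2}\big]$. *)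

(* Defs.v *)
From HB Require Import structures.
From mathcomp Require Import all_boot all_order all_algebra.
From mathcomp Require Import all_classical all_reals all_analysis.

Set Implicit Arguments.
Unset Strict Implicit.
Unset Printing Implicit Defensive.

Import Order.TTheory GRing.Theory Num.Theory.
Import numFieldNormedType.Exports.

Local Open Scope classical_set_scope.
Local Open Scope ring_scope.

Section Definitions.
Context {R : realType} {n : nat}.

(* The norm `|x| of 'rV[R]_n is the sup norm: it induces the usual topology,
   bounded sets and differentiability, but not Euclidean lengths. *)
Definition dot (u v : 'rV[R]_n) : R := \sum_i u 0 i * v 0 i.
Definition enorm (u : 'rV[R]_n) : R := Num.sqrt (dot u u).

Definition frontier (A : set 'rV[R]_n) : set 'rV[R]_n := closure A `\` A°.

Definition gradient (f : 'rV[R]_n -> R) (x : 'rV[R]_n) : 'rV[R]_n :=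
  \row_i 'D_(delta_mx 0 i) f x.

Definition hessian (f : 'rV[R]_n -> R) (x : 'rV[R]_n) : 'M[R]_n :=
  'J (gradient f) x.

(* Functions on a set A are total functions; only their values on A matter.
   The next definition is meant for open A. *)
Definition C2_on (A : set 'rV[R]_n) (f : 'rV[R]_n -> R) : Prop :=
  [/\ forall x, A x -> differentiable f x,
      forall x, A x -> differentiable (gradient f) x &
      {within A, continuous (hessian f)}].

(* Sets of eigenvalues of Hessians of C^2 functions are finite and nonempty
   (for 0 < n), so that sup and inf are a maximum and a minimum. *)
Definition lambda_max (A : 'M[R]_n) : R := sup [set a | eigenvalue A a].
Definition lambda_min (A : 'M[R]_n) : R := inf [set a | eigenvalue A a].

Definition inf_laplacian (f : 'rV[R]_n -> R) (x : 'rV[R]_n) : R :=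
  (enorm (gradient f x) ^+ 2)^-1 *
    dot (gradient f x *m hessian f x) (gradient f x).

Definition inf_laplacian_sup (f : 'rV[R]_n -> R) (x : 'rV[R]_n) : R :=
  if gradient f x != 0 then inf_laplacian f x else lambda_max (hessian f x).

Definition inf_laplacian_inf (f : 'rV[R]_n -> R) (x : 'rV[R]_n) : R :=
  if gradient f x != 0 then inf_laplacian f x else lambda_min (hessian f x).

Definition prec_at (Omega : set 'rV[R]_n) (x : 'rV[R]_n)
    (u v : 'rV[R]_n -> R) : Prop :=
  u x = v x /\ forall y, Omega y -> u y <= v y.

Definition lsc_on (A : set 'rV[R]_n) (u : 'rV[R]_n -> R) : Prop :=
  lower_semicontinuous (fun x : subspace A => (u x)%:E).
Definition usc_on (A : set 'rV[R]_n) (u : 'rV[R]_n -> R) : Prop :=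
  lsc_on A (fun x => - u x).

Definition viscosity_subsolution (Omega : set 'rV[R]_n)
    (u : 'rV[R]_n -> R) : Prop :=
  usc_on Omega u /\
  forall (x : 'rV[R]_n) (phi : 'rV[R]_n -> R), Omega x -> C2_on Omega phi ->
    prec_at Omega x u phi -> - inf_laplacian_sup phi x <= 1.

Definition viscosity_supersolution (Omega : set 'rV[R]_n)
    (u : 'rV[R]_n -> R) : Prop :=
  lsc_on Omega u /\
  forall (x : 'rV[R]_n) (phi : 'rV[R]_n -> R), Omega x -> C2_on Omega phi ->
    prec_at Omega x phi u -> 1 <= - inf_laplacian_inf phi x.

Definition viscosity_solution (Omega : set 'rV[R]_n)
    (u : 'rV[R]_n -> R) : Prop :=
  [/\ {within Omega, continuous u},
      viscosity_subsolution Omega u & viscosity_supersolution Omega u].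

(* u is C^1 on the closure of Omega, and g is the continuous extension of its
   gradient to the closure; for open Omega, g is unique there. *)
Definition C1_closure (Omega : set 'rV[R]_n) (u : 'rV[R]_n -> R)
    (g : 'rV[R]_n -> 'rV[R]_n) : Prop :=
  [/\ {within closure Omega, continuous u},
      forall x, Omega x -> differentiable u x,
      {within closure Omega, continuous g} &
      forall x, Omega x -> g x = gradient u x].

Definition overdetermined_solution (Omega : set 'rV[R]_n) (c : R)
    (u : 'rV[R]_n -> R) : Prop :=
  [/\ viscosity_solution Omega u,
      forall x, frontier Omega x -> u x = 0 &
      exists2 g, C1_closure Omega u g &
        forall x, frontier Omega x -> enorm (g x) = c].

Definition bdist (Omega : set 'rV[R]_n) (x : 'rV[R]_n) : R :=
  inf [set enorm (x - y) | y in frontier Omega].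

Definition inradius (Omega : set 'rV[R]_n) : R :=
  sup [set bdist Omega x | x in closure Omega].

Definition singular_set (Omega : set 'rV[R]_n) : set 'rV[R]_n :=
  [set x | Omega x /\ ~ differentiable (bdist Omega) x].

Definition cut_locus (Omega : set 'rV[R]_n) : set 'rV[R]_n :=
  closure (singular_set Omega).

Definition high_ridge (Omega : set 'rV[R]_n) : set 'rV[R]_n :=
  [set x | closure Omega x /\ bdist Omega x = inradius Omega].

Definition convex (A : set 'rV[R]_n) : Prop :=
  convex_set (A : set (convex_lmodType 'rV[R]_n)).

Definition stadium_like (Omega : set 'rV[R]_n) : Prop :=
  [/\ open Omega, bounded_set Omega, convex Omega &
      cut_locus Omega = high_ridge Omega].

Definition phiN (Omega : set 'rV[R]_n) (x : 'rV[R]_n) : R :=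
  2^-1 * (inradius Omega ^+ 2 - (inradius Omega - bdist Omega x) ^+ 2).

End Definitions.

(* Main.v *)
Require Import Defs.
From HB Require Import structures.
From mathcomp Require Import all_boot all_order all_algebra.
From mathcomp Require Import all_classical all_reals all_analysis.
From mathcomp Require Import ring lra.

Set Implicit Arguments.
Unset Strict Implicit.
Unset Printing Implicit Defensive.

Import Order.TTheory GRing.Theory Num.Theory.
Import numFieldNormedType.Exports.

Local Open Scope classical_set_scope.
Local Open Scope ring_scope.

(** Write [d] for the distance to the frontier, [rho] for the inradius, [M] for the
    high ridge, [K] for the closure of the domain. The radial profiles
    [a + b |y - z| - |y - z|^2/2] solve the equation away from their critical
    points; solutions are controlled by comparison with them.

    A stadium-like domain has a solution. Off [M] the function [d] is
    differentiable with slope one, hence [|x - M| = rho - d x]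
    ([ridge_at_distance]). As [d] is concave, [M] is compact and convex, so
    [u = rho^2/2 - |x - M|^2/2] is differentiable with gradient [proj x - x], a
    Lipschitz map of length [rho] on the frontier. A test function above [u] lies
    above a smooth paraboloid with Hessian [- I]; a test function below [u] is bent
    at least as much as [u] in a direction leading away from [M].

    Rigidity. Let [u] be a solution with constant [c]. Comparison from below on
    balls gives a descent step ([descent_step]): from each interior point one
    reaches a point where [u] is strictly smaller while [|Du|^2/2 + u] has not
    decreased. The maximum of [|Du|^2/2 + u] is therefore found on the frontier,
    where it is [c^2/2] ([P_function_le]). This first-order inequality says that
    [sqrt (c^2 - 2 u)] has slope at most one, which bounds [u] from above by
    [c d - d^2/2] ([frontier_upper_bound]).

    Comparison from above gives an ascent step ([ascent_step]); started near a
    frontier point [p], where [|Du|] is almost [c], it leads to a point [z] with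
    [|z - p| <= c] and [u z >= c^2/2] ([touching_point]). The upper bound then
    forces [d z >= c], and inscribed balls force [c = rho]: every frontier point
    lies on the boundary of an inscribed ball of radius [rho] centred on [M].
    Discrete steps stand in for the gradient flow of [u], whose uniqueness would
    require more than [C^1] regularity.
    Convexity of [M] extends the statement inwards: [|x - M| <= rho - d x] for all
    interior [x] ([ridge_distance_le]). As [u] lies above the paraboloids
    [(rho^2 - |y - m|^2)/2] with [m] in [M], it coincides with [phiN]. Finally [d]
    is a differentiable function of [u] off [M], so it is singular exactly on
    [M]. *)

(** * Euclidean geometry of row vectors *)

Section EuclideanSpace.
Context {R : realType} {n : nat}.
Implicit Types u v w x y : 'rV[R]_n.

Lemma dotC u v : dot u v = dot v u.
Proof. by apply: eq_bigr => i _; rewrite mulrC. Qed.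

Lemma dotDl u v w : dot (u + v) w = dot u w + dot v w.
Proof.
by rewrite /dot -big_split; apply: eq_bigr => i _; rewrite mxE mulrDl.
Qed.

Lemma dotZl (a : R) u w : dot (a *: u) w = a * dot u w.
Proof.
by rewrite /dot mulr_sumr; apply: eq_bigr => i _; rewrite mxE mulrA.
Qed.

Lemma dotNl u w : dot (- u) w = - dot u w.
Proof. by rewrite -scaleN1r dotZl mulN1r. Qed.

Lemma dotBl u v w : dot (u - v) w = dot u w - dot v w.
Proof. by rewrite dotDl dotNl. Qed.

Lemma dot0l w : dot 0 w = 0.
Proof. by rewrite -(scale0r 0) dotZl mul0r. Qed.

Lemma dotDr u v w : dot w (u + v) = dot w u + dot w v.
Proof. by rewrite dotC dotDl !(dotC w). Qed.

Lemma dotZr (a : R) u w : dot w (a *: u) = a * dot w u.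
Proof. by rewrite dotC dotZl (dotC w). Qed.

Lemma dotNr u w : dot w (- u) = - dot w u.
Proof. by rewrite dotC dotNl (dotC w). Qed.

Lemma dotBr u v w : dot w (u - v) = dot w u - dot w v.
Proof. by rewrite dotDr dotNr. Qed.

Lemma dot0r w : dot w 0 = 0.
Proof. by rewrite dotC dot0l. Qed.

Definition dotE := (dotDl, dotDr, dotZl, dotZr, dotNl, dotNr, dot0l, dot0r).

Lemma dot_ge0 u : 0 <= dot u u.
Proof. by apply: sumr_ge0 => i _; rewrite -expr2 sqr_ge0. Qed.

Lemma dot_eq0 u : (dot u u == 0) = (u == 0).
Proof.
apply/idP/eqP => [|->]; last by rewrite dot0l.
rewrite psumr_eq0 => [/allP h|i _]; last by rewrite -expr2 sqr_ge0.
apply/rowP => i; rewrite mxE; apply/eqP.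
have := h i (mem_index_enum i); by rewrite /= mulf_eq0 orbb.
Qed.

Lemma dot_gt0 u : (0 < dot u u) = (u != 0).
Proof. by rewrite lt0r dot_eq0 dot_ge0 andbT. Qed.

Lemma enorm_ge0 u : 0 <= enorm u.
Proof. exact: sqrtr_ge0. Qed.

Lemma enorm_sqr u : enorm u ^+ 2 = dot u u.
Proof. by rewrite sqr_sqrtr// dot_ge0. Qed.

Lemma enorm_eq0 u : (enorm u == 0) = (u == 0).
Proof. by rewrite -sqrf_eq0 enorm_sqr dot_eq0. Qed.

Lemma enorm_gt0 u : (0 < enorm u) = (u != 0).
Proof. by rewrite lt0r enorm_eq0 enorm_ge0 andbT. Qed.

Lemma enorm0 : enorm (0 : 'rV[R]_n) = 0.
Proof. by apply/eqP; rewrite enorm_eq0. Qed.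

Lemma enormN u : enorm (- u) = enorm u.
Proof. by rewrite /enorm dotNl dotNr opprK. Qed.

Lemma enorm_distC u v : enorm (u - v) = enorm (v - u).
Proof. by rewrite -opprB enormN. Qed.

Lemma enormZ (a : R) u : enorm (a *: u) = `|a| * enorm u.
Proof.
by rewrite /enorm dotZl dotZr mulrA -expr2 sqrtrM ?sqr_ge0// sqrtr_sqr.
Qed.

Lemma enorm_leP u (a : R) : 0 <= a -> (enorm u <= a) = (dot u u <= a ^+ 2).
Proof. by move=> a0; rewrite -enorm_sqr ler_pXn2r// nnegrE enorm_ge0. Qed.

Lemma cauchy_schwarz u v : dot u v <= enorm u * enorm v.
Proof.
have [->|v0] := eqVneq v 0; first by rewrite dot0r enorm0 mulr0.
have vv : 0 < dot v v by rewrite dot_gt0.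
have h : dot u v ^+ 2 <= dot u u * dot v v.
  have := dot_ge0 (dot v v *: u - dot u v *: v).
  rewrite !dotE (dotC v u) => h.
  rewrite -subr_ge0 -(pmulr_rge0 _ vv); move: h; congr (_ <= _); ring.
rewrite (le_trans (ler_norm _))// -(ler_pXn2r (ltn0Sn 1)) ?nnegrE ?mulr_ge0 ?enorm_ge0//.
by rewrite real_normK ?num_real// exprMn !enorm_sqr.
Qed.

Lemma enormD u v : enorm (u + v) <= enorm u + enorm v.
Proof.
rewrite enorm_leP ?addr_ge0 ?enorm_ge0// !dotE (dotC v) sqrrD !enorm_sqr.
have := cauchy_schwarz u v; lra.
Qed.

Lemma enorm_triangle w u v : enorm (u - v) <= enorm (u - w) + enorm (w - v).
Proof. by rewrite (_ : u - v = (u - w) + (w - v)) ?enormD// addrA subrK. Qed.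

Lemma mx_entry_le u i : `|u 0 i| <= `|u|.
Proof.
have -> : `|u| = mx_norm u by [].
by rewrite mx_normrE; apply: (le_bigmax_cond _ (fun ij => `|u ij.1 ij.2|) (j := (0, i))).
Qed.

Lemma enorm_le_norm u : enorm u <= n.+1%:R * `|u|.
Proof.
have h0 : (0 : R) <= n.+1%:R * `|u| by rewrite mulr_ge0.
rewrite enorm_leP// /dot.
apply: (@le_trans _ _ (\sum_(i < n) `|u| ^+ 2)).
  apply: ler_sum => i _; rewrite -expr2 -real_normK ?num_real//.
  by rewrite ler_pXn2r ?nnegrE// mx_entry_le.
rewrite sumr_const card_ord exprMn -[leLHS]mulr_natl ler_wpM2r ?sqr_ge0//.
by rewrite -natrX ler_nat (leq_trans (leqnSn n))// -[leqLHS]expn1 leq_pexp2l.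
Qed.

Lemma norm_le_enorm u : `|u| <= enorm u.
Proof.
have -> : `|u| = mx_norm u by [].
rewrite mx_normrE; apply: bigmax_le => [|[j i] _ /=]; first exact: enorm_ge0.
rewrite ord1 -(ler_pXn2r (ltn0Sn 1)) ?nnegrE ?enorm_ge0// enorm_sqr.
rewrite real_normK ?num_real// /dot (bigD1 i)//= -expr2 lerDl.
by apply: sumr_ge0 => k _; rewrite -expr2 sqr_ge0.
Qed.

End EuclideanSpace.

Section EuclideanTopology.
Context {R : realType} {n : nat}.
Implicit Types (x y : 'rV[R]_n) (A : set 'rV[R]_n).

Lemma nbhs_enormP x (P : set 'rV[R]_n) :
  nbhs x P <-> exists2 r : R, 0 < r & forall y, enorm (y - x) < r -> P y.
Proof.
split.
- move=> /nbhs_normP[r /= r0 hr]; exists r => // y hy; apply: hr => /=.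
  by rewrite (le_lt_trans _ hy)// distrC norm_le_enorm.
- move=> [r r0 hr]; apply/nbhs_ballP; exists (r / n.+1%:R) => /=.
    by rewrite divr_gt0.
  move=> y; rewrite -ball_normE /= => hy; apply: hr; rewrite (le_lt_trans (enorm_le_norm _))//.
  by rewrite mulrC -ltr_pdivlMr// distrC.
Qed.

Lemma open_enormP A x : open A -> A x ->
  exists2 r : R, 0 < r & forall y, enorm (y - x) < r -> A y.
Proof. by move=> oA Ax; apply/nbhs_enormP/open_nbhs_nbhs. Qed.

Lemma closure_enormP A x :
  closure A x <-> forall r : R, 0 < r -> exists2 y, A y & enorm (y - x) < r.
Proof.
split=> [h r r0|h B /nbhs_enormP[r r0 hr]].
  have /h[y [Ay hy]] : nbhs x [set y | enorm (y - x) < r].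
    by apply/nbhs_enormP; exists r.
  by exists y.
by have [y Ay hy] := h _ r0; exists y; split=> //; apply: hr.
Qed.

Lemma lipschitz_continuous (f : 'rV[R]_n -> R) (C : R) :
  (forall x y, `|f x - f y| <= C * enorm (x - y)) -> continuous f.
Proof.
move=> hf x; apply/(@cvgrPdist_lt _ _ _ (nbhs x)) => e e0; apply/nbhs_enormP.
have hC : 0 < `|C| + 1 by rewrite ltr_wpDl.
exists (e / (`|C| + 1)) => [|y hy]; first by rewrite divr_gt0.
rewrite (le_lt_trans (hf _ _))//.
move: hy; rewrite ltr_pdivlMr// enorm_distC mulrC; apply: le_lt_trans.
rewrite ler_wpM2r ?enorm_ge0// (le_trans (ler_norm _))// lerDl//.
Qed.

Lemma lipschitz_continuous_rV (f : 'rV[R]_n -> 'rV[R]_n) (C : R) :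
  (forall x y, enorm (f x - f y) <= C * enorm (x - y)) -> continuous f.
Proof.
move=> hf x; apply/(@cvgrPdist_lt _ _ _ (nbhs x)) => e e0; apply/nbhs_enormP.
have hC : 0 < `|C| + 1 by rewrite ltr_wpDl.
exists (e / (`|C| + 1)) => [|y hy]; first by rewrite divr_gt0.
rewrite (le_lt_trans (norm_le_enorm _))// (le_lt_trans (hf _ _))//.
move: hy; rewrite ltr_pdivlMr// enorm_distC mulrC; apply: le_lt_trans.
rewrite ler_wpM2r ?enorm_ge0// (le_trans (ler_norm _))// lerDl//.
Qed.

Lemma enorm_lipschitz x y : `|enorm x - enorm y| <= enorm (x - y).
Proof.
rewrite ler_norml; apply/andP; split.
  have := enorm_triangle x y 0; rewrite !subr0 (enorm_distC y); lra.
have := enorm_triangle y x 0; rewrite !subr0; lra.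
Qed.

Lemma enorm_continuous : continuous (@enorm R n).
Proof.
by apply: (@lipschitz_continuous _ 1) => x y; rewrite mul1r enorm_lipschitz.
Qed.

Lemma edist_continuous y : continuous (fun x => enorm (x - y)).
Proof.
apply: (@lipschitz_continuous _ 1) => x z; rewrite mul1r.
by rewrite (le_trans (enorm_lipschitz _ _))// opprB addrA subrK.
Qed.

Lemma within_enormP A (f : 'rV[R]_n -> R) x : {within A, continuous f} -> A x ->
  forall e : R, 0 < e ->
  exists2 r : R, 0 < r & forall y, A y -> enorm (y - x) < r -> `|f y - f x| < e.
Proof.
move=> /subspace_continuousP/(_ x) hf Ax e e0.
have /nbhs_enormP[r r0 hr] : nbhs x [set y | A y -> `|f x - f y| < e].
  by have := hf Ax; move/(@cvgrPdist_lt _ _ _ (within A (nbhs x))) => /(_ _ e0).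
by exists r => // y Ay hy; rewrite distrC hr.
Qed.

End EuclideanTopology.

(** * Calculus along lines *)

Lemma littleo_is_diff (R : realType) (V W : normedModType R) (f : V -> W) (x : V)
    (L : {linear V -> W}) : continuous L ->
  (forall e : R, 0 < e ->
     \forall z \near (0 : V), `|f (z + x) - (f x + L z)| <= e * `|z|) ->
  is_diff x f L.
Proof.
move=> cL hf; have hL : f \o shift x = cst (f x) + L +o_ 0 id by apply/eqaddoP.
have dE : 'd f x = L :> (_ -> _) by apply: diff_unique.
by split => //; apply/diff_locallyP; rewrite dE.
Qed.

Section CalculusOnLines.
Context {R : realType} {n : nat}.
Implicit Types (x y v w z : 'rV[R]_n).

Lemma diff_enormP (W : normedModType R) (f : 'rV[R]_n -> W) x :
  differentiable f x -> forall e : R, 0 < e -> exists2 r : R, 0 < r &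
    forall z, enorm z < r -> `|f (x + z) - f x - 'd f x z| <= e * enorm z.
Proof.
move=> /diff_locally/eqaddoP h e e0; have /nbhs_enormP[r r0 hr] := h _ e0; exists r => // z zr.
have /hr /= : enorm (z - 0) < r by rewrite subr0.
rewrite -[(_ - _) z]/(f (z + x) - (f x + 'd f x z)) opprD addrA addrC (addrC x).
move=> /le_trans; rewrite addrC; apply.
by apply: ler_wpM2l; [exact: ltW | exact: norm_le_enorm].
Qed.

Lemma enorm_is_diff (W : normedModType R) (f : 'rV[R]_n -> W) x
    (L : {linear 'rV[R]_n -> W}) : continuous L ->
  (forall e : R, 0 < e -> exists2 r : R, 0 < r &
    forall z, enorm z < r -> `|f (x + z) - f x - L z| <= e * enorm z) ->
  is_diff x f L.
Proof.
move=> cL hf.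
apply: littleo_is_diff => // e e0.
have [|r r0 hr] := hf (e / n.+1%:R); first by rewrite divr_gt0.
apply/nbhs_enormP; exists r => // z; rewrite subr0 => /hr.
rewrite opprD addrA (addrC z) => /le_trans; apply.
by rewrite -mulrA; apply: ler_wpM2l; [exact: ltW | rewrite ler_pdivrMl//; exact: enorm_le_norm].
Qed.

Lemma diff_gradient (f : 'rV[R]_n -> R) x v :
  differentiable f x -> 'd f x v = dot (gradient f x) v.
Proof.
move=> df; rewrite {1}(row_sum_delta v) linear_sum /dot.
by apply: eq_bigr => i _; rewrite linearZ/= mxE deriveE// mulrC.
Qed.

Lemma is_derive_line (W : normedModType R) (f : 'rV[R]_n -> W) x v (t : R) :
  differentiable f (x + t *: v) ->
  is_derive t 1 (fun s : R => f (x + s *: v)) ('d f (x + t *: v) v).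
Proof.
move=> df; set F := fun s : R => f (x + s *: v).
have E : (fun h : R => h^-1 *: ((F \o shift t) (h *: 1) - F t)) =
    (fun h : R => h^-1 *: ((f \o shift (x + t *: v)) (h *: v) - f (x + t *: v))).
  apply/funext => h; rewrite /F /=; congr (_ *: (f _ - _)).
  by rewrite [h *: 1]mulr1 scalerDl addrCA.
split; first by rewrite /derivable E; apply: diff_derivable.
by rewrite /derive E -deriveE.
Qed.

Lemma is_derive_line_gradient (f : 'rV[R]_n -> R) x v (t : R) :
  differentiable f (x + t *: v) ->
  is_derive t 1 (fun s : R => f (x + s *: v)) (dot (gradient f (x + t *: v)) v).
Proof. by move=> df; rewrite -diff_gradient//; exact: is_derive_line. Qed.

Lemma near_differentiable (f h : 'rV[R]_n -> R) x : differentiable f x ->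
  (exists2 r, 0 < r & forall y, enorm (y - x) < r -> f y = h y) ->
  differentiable h x.
Proof.
move=> df [r r0 fh]; have hx : f x = h x by apply: fh; rewrite subrr enorm0.
suff [] : is_diff x h ('d f x) by [].
apply: enorm_is_diff; first exact: diff_continuous.
move=> e e0; have [r1 r10 hr1] := diff_enormP df e0.
exists (Num.min r r1) => [|z]; first by rewrite lt_min r0.
rewrite lt_min => /andP[zr zr1]; rewrite -hx -fh; first exact: hr1.
by rewrite addrC addKr.
Qed.

End CalculusOnLines.

(** * One-sided necessary conditions *)

Section OneSidedConditions.
Context {R : realType}.
Implicit Types (h k : R -> R) (t a b e tau : R).

Lemma le_of_slack (A B C : R) : (forall t, 0 < t -> t < 1 -> A <= B + t * C) -> A <= B.
Proof.
move=> h; apply/ler_addgt0Pr => e e0.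
pose t := Num.min (1 / 2) (e / (`|C| + 1)).
have C1 : 0 < `|C| + 1 by rewrite ltr_wpDl.
have t0 : 0 < t by rewrite lt_min !divr_gt0.
have t1 : t < 1 by rewrite gt_min; apply/orP; left; lra.
have tC : t * (`|C| + 1) <= e by rewrite -ler_pdivlMr// ge_min lexx orbT.
apply: (le_trans (h _ t0 t1)); rewrite lerD2l; apply: le_trans tC.
by rewrite ler_wpM2l ?(ltW t0)// (le_trans (ler_norm C))// lerDl.
Qed.

Lemma is_derive_eps h (h1 t0 : R) : is_derive t0 1 h h1 ->
  forall e, 0 < e -> exists2 d : R, 0 < d &
    forall t, `|t| < d -> `|h (t0 + t) - h t0 - h1 * t| <= e * `|t|.
Proof.
move=> dh e e0.
have := @derivable_nbhs _ _ _ h t0 1 (@ex_derive _ _ _ _ _ _ _ dh).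
rewrite (@derive_val _ _ _ _ _ _ _ dh) => /eqaddoP/(_ _ e0)/nbhs_ballP[d d0 hd].
exists d => // t td; have := hd t; rewrite -ball_normE /= sub0r normrN => /(_ td).
rewrite -[(_ - _) t]/(h (t *: 1 + t0) - (h t0 + t *: h1)) [t *: 1]mulr1.
by rewrite [t *: h1]mulrC (addrC t t0) opprD addrA.
Qed.

(** First- and second-order necessary conditions at an end point of an
    interval. They are one-sided because the test directions used below may
    leave the domain on the other side. *)
Lemma derive_le_of_upper h (h1 a C tau : R) : is_derive (0 : R) 1 h h1 -> 0 < tau ->
  (forall t, 0 < t -> t < tau -> h t <= h 0 + a * t + C * t ^+ 2) -> h1 <= a.
Proof.
move=> dh tau0 hh; apply/ler_addgt0Pr => e e0.
have e20 : 0 < e / 2 by lra.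
have [d d0 hd] := is_derive_eps dh e20.
pose c := `|C| + 1; have c0 : 0 < c by rewrite ltr_wpDl.
pose t := Num.min (tau / 2) (Num.min (d / 2) (e / 2 / c)).
have t0 : 0 < t by rewrite !lt_min !divr_gt0.
have td : t < d by rewrite /t !gt_min; apply/orP; right; apply/orP; left; lra.
have tt : t < tau by rewrite /t !gt_min; apply/orP; left; lra.
have tc : c * t <= e / 2.
  by rewrite mulrC -ler_pdivlMr// /t !ge_min lexx !orbT.
have := hh _ t0 tt; have := hd t; rewrite add0r (gtr0_norm t0) => /(_ td).
rewrite ler_norml => /andP[+ _] ht.
have hC : C * t ^+ 2 <= e / 2 * t.
  apply: (@le_trans _ _ (c * t * t)); last by rewrite ler_pM2r.
  rewrite -mulrA -expr2 ler_wpM2r ?sqr_ge0//.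
  by rewrite (le_trans (ler_norm _))// lerDl.
move=> h'; have : h1 * t <= (a + e) * t by lra.
by rewrite ler_pM2r.
Qed.

Lemma derive_ge_of_lower h (h1 a C tau : R) : is_derive (0 : R) 1 h h1 -> 0 < tau ->
  (forall t, 0 < t -> t < tau -> h 0 + a * t + C * t ^+ 2 <= h t) -> a <= h1.
Proof.
move=> dh tau0 hh; have dN : is_derive (0 : R) 1 (- h) (- h1) by apply: is_deriveN.
rewrite -lerN2; apply: (@derive_le_of_upper _ _ _ (- C) _ dN tau0) => t t0 tt.
have := hh _ t0 tt; rewrite -[(- h) t]/(- h t) -[(- h) 0]/(- h 0); lra.
Qed.

Lemma is_derive_quadratic a b t :
  is_derive t 1 (fun x : R => a * x + b / 2 * x ^+ 2) (a + b * t).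
Proof.
have -> : (fun x : R => a * x + b / 2 * x ^+ 2) = a *: id + (b / 2) *: (id ^+ 2) by [].
have d1 := is_deriveZ a (is_derive_id t (1 : R)).
have d2 := is_deriveZ (b / 2) (is_deriveX 2 (is_derive_id t (1 : R))).
apply: is_derive_eq (is_deriveD d1 d2) _.
by rewrite -![_ *: _]/(_ * _) /= expr1; field.
Qed.

Lemma derive2_le_of_upper h h1 (h2 b tau : R) : 0 < tau ->
  (forall t, 0 <= t -> t < tau -> is_derive t 1 h (h1 t)) ->
  is_derive (0 : R) 1 h1 h2 ->
  (forall t, 0 < t -> t < tau -> h t <= h 0 + h1 0 * t + b / 2 * t ^+ 2) ->
  h2 <= b.
Proof.
move=> tau0 dh dh1 hh; rewrite leNgt; apply/negP => bh2.
have e0 : 0 < (h2 - b) / 2 by lra.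
have [d d0 hd] := is_derive_eps dh1 e0.
pose t := Num.min (tau / 2) (d / 2).
have t0 : 0 < t by rewrite !lt_min !divr_gt0.
have td : t < d by rewrite /t !gt_min; apply/orP; right; lra.
have tt : t < tau by rewrite /t !gt_min; apply/orP; left; lra.
pose k s := h s - (h1 0 * s + b / 2 * s ^+ 2).
have dk s : 0 <= s -> s < tau -> is_derive s 1 k (h1 s - (h1 0 + b * s)).
  move=> s0 st; have := dh _ s0 st => dhs.
  apply: is_deriveB.
  exact: is_derive_quadratic.
have ck : {within `[0, t], continuous k}.
  apply: derivable_within_continuous => s; rewrite in_itv/= => /andP[s0 st].
  by apply: ex_derive; apply: dk => //; lra.
have [|c] := MVT (df := fun s => h1 s - (h1 0 + b * s)) t0 _ ck.
  by move=> s; rewrite in_itv/= => /andP[s0 st]; apply: dk; lra.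
rewrite in_itv/= => /andP[c0 ct]; rewrite subr0 => ek.
have : k 0 < k t.
  rewrite -subr_gt0 ek mulr_gt0//.
  have := hd c; rewrite add0r gtr0_norm// => /(_ (lt_trans ct td)).
  rewrite ler_norml => /andP[+ _].
  have : 0 < (h2 - b) / 2 * c by rewrite mulr_gt0.
  lra.
rewrite /k; have := hh _ t0 tt; lra.
Qed.

Lemma derive2_ge_of_lower h h1 (h2 b tau : R) : 0 < tau ->
  (forall t, 0 <= t -> t < tau -> is_derive t 1 h (h1 t)) ->
  is_derive (0 : R) 1 h1 h2 ->
  (forall t, 0 < t -> t < tau -> h 0 + h1 0 * t + b / 2 * t ^+ 2 <= h t) ->
  b <= h2.
Proof.
move=> tau0 dh dh1 hh; rewrite -lerN2.
apply: (@derive2_le_of_upper (- h) (- h1) _ _ tau) => //.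
- by move=> t t0 tt; have := dh _ t0 tt => ?; exact: is_deriveN.
- move=> t t0 tt; have := hh _ t0 tt.
  rewrite -[(- h) t]/(- h t) -[(- h) 0]/(- h 0) -[(- h1) 0]/(- h1 0); lra.
Qed.

End OneSidedConditions.

(** * Gradients and Hessians in a given direction *)

Section GradientConditions.
Context {R : realType} {n : nat}.
Implicit Types (x y v w z : 'rV[R]_n) (i : 'I_n) (f phi : 'rV[R]_n -> R).

Definition dotr v : 'rV[R]_n -> R := fun w => dot w v.

Fact dotr_is_linear v : linear (dotr v).
Proof. by move=> a u w; rewrite /dotr dotDl dotZl. Qed.

HB.instance Definition _ v :=
  GRing.isLinear.Build R 'rV[R]_n R _ (dotr v) (dotr_is_linear v).

Lemma dotr_continuous v : continuous (dotr v).
Proof.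
apply: (@lipschitz_continuous _ _ _ (enorm v)) => x y; rewrite /dotr -dotBl.
rewrite ler_norml mulrC cauchy_schwarz andbT lerNl -dotNl -(enormN (x - y)).
exact: cauchy_schwarz.
Qed.

Lemma is_diff_dotr v x : is_diff x (dotr v) (dotr v).
Proof.
by split; [exact/linear_differentiable/dotr_continuous|exact/diff_lin/dotr_continuous].
Qed.

Lemma dot_delta v i : dot v (delta_mx 0 i) = v 0 i.
Proof.
rewrite /dot (bigD1 i)//= big1 ?addr0 ?mxE ?eqxx ?mulr1// => j /negPf ji.
by rewrite mxE ji andbF mulr0.
Qed.

Lemma is_derive_line0 f x v : differentiable f x ->
  is_derive (0 : R) 1 (fun s : R => f (x + s *: v)) (dot (gradient f x) v).
Proof.
by have := @is_derive_line_gradient _ _ f x v 0; rewrite scale0r addr0; exact.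
Qed.

Lemma gradient_le f x v (a C tau : R) : differentiable f x -> 0 < tau ->
  (forall t, 0 < t -> t < tau -> f (x + t *: v) <= f x + a * t + C * t ^+ 2) ->
  dot (gradient f x) v <= a.
Proof.
move=> df tau0 hf.
by apply: (derive_le_of_upper (is_derive_line0 v df) tau0 (C := C)) => t; rewrite scale0r addr0; exact: hf.
Qed.

Lemma gradient_ge f x v (a C tau : R) : differentiable f x -> 0 < tau ->
  (forall t, 0 < t -> t < tau -> f x + a * t + C * t ^+ 2 <= f (x + t *: v)) ->
  a <= dot (gradient f x) v.
Proof.
move=> df tau0 hf.
by apply: (derive_ge_of_lower (is_derive_line0 v df) tau0 (C := C)) => t; rewrite scale0r addr0; exact: hf.
Qed.

Lemma diff_hessian phi x z : differentiable (gradient phi) x ->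
  'd (gradient phi) x z = z *m hessian phi x.
Proof. by move=> dg; rewrite -deriveE// deriveEjacobian. Qed.

Lemma is_diff_gradient_dot phi x v : differentiable (gradient phi) x ->
  is_diff x (dotr v \o gradient phi) (fun z => dot (z *m hessian phi x) v).
Proof.
move=> dg.
apply: is_diff_eq (is_diff_comp (differentiableP dg) (is_diff_dotr _ _)) _.
by apply/funext => z /=; rewrite diff_hessian.
Qed.

Lemma open_segment (A : set 'rV[R]_n) x v : open A -> A x ->
  exists2 tau : R, 0 < tau & forall t, `|t| < tau -> A (x + t *: v).
Proof.
move=> oA /(open_enormP oA)[r r0 hr].
have v0 : 0 < enorm v + 1 by rewrite ltr_wpDl ?enorm_ge0.
exists (r / (enorm v + 1)) => [|t ht]; first by rewrite divr_gt0.
apply: hr; rewrite addrC addKr enormZ; move: ht; rewrite ltr_pdivlMr//.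
by apply: le_lt_trans; rewrite ler_wpM2l// lerDl.
Qed.

Lemma C2_along_line (A : set 'rV[R]_n) phi x v : open A -> A x -> C2_on A phi ->
  exists r : R, [/\ 0 < r,
    forall t, 0 <= t -> t < r -> is_derive t 1
      (fun s : R => phi (x + s *: v)) (dot (gradient phi (x + t *: v)) v) &
    is_derive (0 : R) 1 (fun t : R => dot (gradient phi (x + t *: v)) v)
      (dot (v *m hessian phi x) v)].
Proof.
move=> oA Ax [dphi dg _]; have [r r0 hr] := open_segment v oA Ax.
exists r; split=> // [t t0 tr|].
  by apply: is_derive_line_gradient; apply: dphi; apply: hr; rewrite ger0_norm.
have [d e] := is_diff_gradient_dot v (dg _ Ax).
have := @is_derive_line _ _ _ (dotr v \o gradient phi) x v 0.
by rewrite scale0r addr0 e; apply.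
Qed.

Lemma hessian_le (A : set 'rV[R]_n) phi x v (b tau : R) : open A -> A x ->
  C2_on A phi -> 0 < tau ->
  (forall t, 0 < t -> t < tau ->
    phi (x + t *: v) <= phi x + dot (gradient phi x) v * t + b / 2 * t ^+ 2) ->
  dot (v *m hessian phi x) v <= b.
Proof.
move=> oA Ax Cphi tau0 hphi; have [r [r0 dl dd]] := C2_along_line v oA Ax Cphi.
have m0 : 0 < Num.min r tau by rewrite lt_min r0.
have {}dl t : 0 <= t -> t < Num.min r tau -> is_derive t 1
    (fun s : R => phi (x + s *: v)) (dot (gradient phi (x + t *: v)) v).
  by move=> t0; rewrite lt_min => /andP[tr _]; exact: dl.
apply: (derive2_le_of_upper m0 dl dd) => t t0.
by rewrite lt_min => /andP[_]; rewrite scale0r addr0; exact: hphi.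
Qed.

Lemma hessian_ge (A : set 'rV[R]_n) phi x v (b tau : R) : open A -> A x ->
  C2_on A phi -> 0 < tau ->
  (forall t, 0 < t -> t < tau ->
    phi x + dot (gradient phi x) v * t + b / 2 * t ^+ 2 <= phi (x + t *: v)) ->
  b <= dot (v *m hessian phi x) v.
Proof.
move=> oA Ax Cphi tau0 hphi; have [r [r0 dl dd]] := C2_along_line v oA Ax Cphi.
have m0 : 0 < Num.min r tau by rewrite lt_min r0.
have {}dl t : 0 <= t -> t < Num.min r tau -> is_derive t 1
    (fun s : R => phi (x + s *: v)) (dot (gradient phi (x + t *: v)) v).
  by move=> t0; rewrite lt_min => /andP[tr _]; exact: dl.
apply: (derive2_ge_of_lower m0 dl dd) => t t0.
by rewrite lt_min => /andP[_]; rewrite scale0r addr0; exact: hphi.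
Qed.

(** The mean value theorem is applied in the direction [v] only, so that the
    expansion treats [v] and [w] differently although the second difference does
    not: this asymmetry is what makes the Hessian symmetric. *)
Lemma second_difference (A : set 'rV[R]_n) phi x v w : open A -> A x ->
  C2_on A phi -> forall e : R, 0 < e -> exists2 r : R, 0 < r &
    forall t, 0 < t -> t < r ->
      `|phi (x + t *: w + t *: v) - phi (x + t *: w) - phi (x + t *: v) + phi x
        - t ^+ 2 * dot (w *m hessian phi x) v| <= e * t ^+ 2.
Proof.
move=> oA Ax [dphi dg _] e e0; have [r0 r00 hr0] := open_enormP oA Ax.
pose c := enorm v + enorm w + 1.
have c0 : 0 < c by rewrite ltr_wpDl// addr_ge0 ?enorm_ge0.
have [d eF] := is_diff_gradient_dot v (dg _ Ax).
have e20 : 0 < e / 2 / c by rewrite !divr_gt0.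
have [r1 r10 hr1] := diff_enormP d e20.
rewrite eF /= /dotr in hr1.
exists (Num.min r0 r1 / c) => [|t t0]; first by rewrite divr_gt0// lt_min r00.
rewrite ltr_pdivlMr// lt_min => /andP[tr0 tr1].
have hz s (a : R) : 0 <= s <= t -> 0 <= a <= t -> enorm (a *: w + s *: v) <= t * c.
  move=> /andP[s0 st] /andP[a0 at_].
  rewrite (le_trans (enormD _ _))// !enormZ !ger0_norm//.
  have := ler_wpM2r (enorm_ge0 w) at_; have := ler_wpM2r (enorm_ge0 v) st.
  rewrite /c; lra.
pose p s := phi (x + t *: w + s *: v) - phi (x + s *: v).
pose dp s := dot (gradient phi (x + t *: w + s *: v)) v - dot (gradient phi (x + s *: v)) v.
have dpE s : 0 <= s <= t -> is_derive s 1 p (dp s).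
  move=> hs; apply: is_deriveB; apply: is_derive_line_gradient; apply: dphi; apply: hr0.
    rewrite -[x + _ + _]addrA [_ - x]addrC addKr (le_lt_trans (hz _ _ hs _) tr0)//.
    by rewrite lexx ltW.
  rewrite addrC addKr -[X in enorm X]add0r -(scale0r w) (le_lt_trans (hz _ _ hs _) tr0)//.
  by rewrite lexx ltW.
have cp : {within `[0, t], continuous p}.
  apply: derivable_within_continuous => s; rewrite in_itv/= => hs.
  by apply: ex_derive; apply: dpE.
have [|s] := MVT (df := dp) t0 _ cp.
  by move=> s; rewrite in_itv/= => /andP[s0 st]; apply: dpE; rewrite !ltW.
rewrite in_itv/= => /andP[s0 st].
have hs : 0 <= s <= t by rewrite !ltW.
rewrite /p /dp !scale0r !addr0 subr0 => hp.
have ct : e / 2 * t = e / 2 / c * (t * c).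
  by rewrite (mulrC t) mulrA divfK// lt0r_neq0.
have h1 : `|dot (gradient phi (x + (t *: w + s *: v))) v - dot (gradient phi x) v
   - dot ((t *: w + s *: v) *m hessian phi x) v| <= e / 2 * t.
  have hh : enorm (t *: w + s *: v) <= t * c by rewrite hz// lexx ltW.
  rewrite (le_trans (hr1 _ _))// ?(le_lt_trans hh)//.
  by rewrite ct ler_wpM2l// ltW.
have h2 : `|dot (gradient phi (x + s *: v)) v - dot (gradient phi x) v
   - dot ((s *: v) *m hessian phi x) v| <= e / 2 * t.
  have hh : enorm (s *: v) <= t * c.
    by rewrite -[X in enorm X]add0r -(scale0r w) hz// lexx ltW.
  rewrite (le_trans (hr1 _ _))// ?(le_lt_trans hh)//.
  by rewrite ct ler_wpM2l// ltW.
move: h1 h2 hp; rewrite addrA mulmxDl -!scalemxAl !dotE.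
set a1 := dot (gradient _ _) _; set a2 := dot (gradient _ _) _.
set a3 := dot (gradient _ _) _; set q := dot (w *m _) _; set q' := dot (v *m _) _.
move=> h1 h2 hp.
have -> : phi (x + t *: w + t *: v) - phi (x + t *: w) - phi (x + t *: v) + phi x
   - t ^+ 2 * q = (a1 - a3 - t * q) * t by move: hp; lra.
rewrite normrM (gtr0_norm t0) expr2 mulrA ler_pM2r//.
move: h1 h2; rewrite !ler_norml => /andP[h1 h1'] /andP[h2 h2']; apply/andP; split; lra.
Qed.

Lemma hessian_sym (A : set 'rV[R]_n) phi x v w : open A -> A x -> C2_on A phi ->
  dot (w *m hessian phi x) v = dot (v *m hessian phi x) w.
Proof.
move=> oA Ax hphi; apply/eqP; rewrite -subr_eq0 -normr_le0; apply/ler_addgt0Pr => e e0.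
have e20 : 0 < e / 2 by lra.
have [r r0 hr] := second_difference v w oA Ax hphi e20.
have [s s0 hs] := second_difference w v oA Ax hphi e20.
pose t := Num.min r s / 2.
have m0 : 0 < Num.min r s by rewrite lt_min r0.
have [tr ts] : t < r /\ t < s.
  have : t < Num.min r s by rewrite /t; lra.
  by rewrite lt_min => /andP.
have t0 : 0 < t by rewrite divr_gt0.
have t20 : 0 < t ^+ 2 by rewrite exprn_gt0.
rewrite add0r -(ler_pM2l t20) -{1}(gtr0_norm t20) -normrM.
have := hr _ t0 tr; have := hs _ t0 ts.
rewrite (addrAC x (t *: v)).
rewrite !ler_norml => /andP[h1 h1'] /andP[h2 h2']; apply/andP; split; lra.
Qed.

End GradientConditions.

(** * Extreme eigenvalues of symmetric matrices *)

Section Rayleigh.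
Context {R : realType} {n : nat}.
Implicit Types (A : 'M[R]_n) (v w : 'rV[R]_n).

Lemma continuous_sum (T : topologicalType) (I : finType) (F : I -> T -> R) :
  (forall i, continuous (F i)) -> continuous (fun x => \sum_i F i x).
Proof.
move=> cF; have -> : (fun x => \sum_i F i x) = \sum_i F i.
  by apply/funext => x; rewrite fct_sumE.
apply: (big_ind (fun f : T -> R => continuous f)) => //.
- by move=> x; apply: cst_continuous.
- by move=> f g cf cg x; apply: continuousD; [exact: cf|exact: cg].
Qed.

Lemma continuous_quadratic A : continuous (fun v => dot (v *m A) v).
Proof.
apply: continuous_sum => i v; apply: continuousM; last exact: coord_continuous.
have -> : (fun v : 'rV[R]_n => (v *m A) 0 i) = (fun v => \sum_j v 0 j * A j i).
  by apply/funext => w; rewrite mxE.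
apply: continuous_sum => j w; apply: continuousM; first exact: coord_continuous.
exact: cst_continuous.
Qed.

Lemma continuous_dot2 : continuous (fun v : 'rV[R]_n => dot v v).
Proof.
have -> : (fun v : 'rV[R]_n => dot v v) = (fun v => dot (v *m 1%:M) v).
  by apply/funext => v; rewrite mulmx1.
exact: continuous_quadratic.
Qed.

Lemma enorm_bounded_set (S : set 'rV[R]_n) (r : R) :
  (forall v, S v -> enorm v <= r) -> bounded_set S.
Proof.
move=> hS; exists r; split; first exact: num_real.
by move=> s rs v /hS h /=; rewrite (le_trans (norm_le_enorm v))// (le_trans h)// ltW.
Qed.

Lemma compact_esphere (x : 'rV[R]_n) (r : R) : compact [set v | enorm (v - x) = r].
Proof.
apply: bounded_closed_compact.
  apply: (@enorm_bounded_set _ (r + enorm x)) => v /= <-.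
  by rewrite (le_trans _ (enormD _ _))// subrK.
apply: (@preimage_closed _ _ (fun v => enorm (v - x)) [set r]).
  by move=> v _; apply: edist_continuous.
exact: closed_eq.
Qed.

(** With [l] the maximum of the form on the unit sphere, [l |v|^2 - v A v] is
    nonnegative and vanishes at a maximiser [u]; its first variation then
    vanishes at [u] as well, which makes [u] an eigenvector. *)
Lemma rayleigh_max A : (0 < n)%N ->
  (forall v w, dot (v *m A) w = dot (w *m A) v) ->
  exists2 l, eigenvalue A l & forall v, dot (v *m A) v <= l * dot v v.
Proof.
move=> n0 symA; pose i0 := Ordinal n0.
pose S := [set v : 'rV[R]_n | enorm (v - 0) = 1].
have S0 : S !=set0.
  exists (delta_mx 0 i0); rewrite /S/= subr0 /enorm /dot (bigD1 i0)//= big1.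
    by rewrite addr0 mxE !eqxx mulr1 sqrtr1.
  by move=> i /negPf ii0; rewrite !mxE ii0 andbF mul0r.
have [|u /set_mem Su hu] := compact_EVT_max (f := fun v => dot (v *m A) v) S0 (@compact_esphere 0 1).
  exact/continuous_subspaceT/continuous_quadratic.
set l := dot (u *m A) u in hu.
have uu : dot u u = 1 by move: Su; rewrite /S/= subr0 -enorm_sqr => ->; rewrite expr1n.
have hl v : dot (v *m A) v <= l * dot v v.
  have [->|v0] := eqVneq v 0; first by rewrite mul0mx !dot0l mulr0.
  have ev : 0 < enorm v by rewrite enorm_gt0.
  have : dot (((enorm v)^-1 *: v) *m A) ((enorm v)^-1 *: v) <= l.
    apply: hu; apply/mem_set; rewrite /S/= subr0 enormZ ger0_norm ?invr_ge0 ?enorm_ge0//.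
    by rewrite mulVf// lt0r_neq0.
  rewrite -scalemxAl !dotE mulrA -expr2 exprVn enorm_sqr.
  by rewrite ler_pdivrMl ?dot_gt0// mulrC.
exists l => //; apply/eigenvalueP; exists u; last first.
  by apply/negP => /eqP u0; move: uu; rewrite u0 dot0l => /esym/eqP; rewrite oner_eq0.
have [z zE] : exists z, u *m A = z + l *: u.
  by exists (u *m A - l *: u); rewrite subrK.
suff /eqP z0 : z == 0 by rewrite zE z0 add0r.
rewrite -dot_eq0.
apply/negPn/negP => zz; have zz0 : 0 < dot z z by rewrite lt0r zz dot_ge0.
(* perturbing the maximiser by a multiple of the residual z *)
have key (t : R) : 0 < t -> 2 * dot z z <= t * (l * dot z z - dot (z *m A) z).
  move=> t0; have := hl (u + t *: z).
  rewrite mulmxDl -scalemxAl !dotE -/l uu (symA z u) (dotC z u).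
  have -> : dot (u *m A) z = dot z z + l * dot u z by rewrite zE !dotE.
  move=> h; rewrite -(ler_pM2l t0); lra.
pose c : R := `|l * dot z z - dot (z *m A) z| + 1.
have c0 : 0 < c by rewrite ltr_wpDl.
have t0 : 0 < dot z z / c by rewrite divr_gt0.
have := key _ t0; apply/negP; rewrite -ltNge.
apply: (@le_lt_trans _ _ (dot z z / c * c)); last by rewrite divfK ?lt0r_neq0//; lra.
apply: ler_wpM2l; first exact: ltW.
by rewrite (le_trans (ler_norm _))// lerDl.
Qed.

Lemma eigenvalue_le A (a b : R) : eigenvalue A a ->
  (forall v, dot (v *m A) v <= b * dot v v) -> a <= b.
Proof.
move=> /eigenvalueP[v va v0] h; have := h v.
by rewrite va dotZl ler_pM2r// dot_gt0.
Qed.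

Lemma lambda_max_ge A (b : R) v : (0 < n)%N ->
  (forall v w, dot (v *m A) w = dot (w *m A) v) ->
  v != 0 -> b * dot v v <= dot (v *m A) v -> b <= lambda_max A.
Proof.
move=> n0 symA v0 bv; have [l el hl] := rayleigh_max n0 symA.
apply: (@le_trans _ _ l).
  by have := le_trans bv (hl v); rewrite ler_pM2r// dot_gt0.
apply: ub_le_sup => //; exists l => a /= ea; exact: eigenvalue_le hl.
Qed.

Lemma lambda_max_le A (b : R) : (0 < n)%N ->
  (forall v w, dot (v *m A) w = dot (w *m A) v) ->
  (forall v, dot (v *m A) v <= b * dot v v) -> lambda_max A <= b.
Proof.
move=> n0 symA bv; have [l el _] := rayleigh_max n0 symA.
by apply: ge_sup; [exists l|move=> a /= ea; exact: eigenvalue_le bv].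
Qed.

Lemma lambda_minE A : lambda_min A = - lambda_max (- A).
Proof.
rewrite /lambda_min /lambda_max /inf; congr (- sup _).
apply/seteqP; split => [_ /= [a /eigenvalueP[v va v0] <-]|a /= /eigenvalueP[v va v0]].
  by apply/eigenvalueP; exists v => //; rewrite mulmxN va scaleNr.
exists (- a); last by rewrite opprK.
by apply/eigenvalueP; exists v => //; rewrite scaleNr -va mulmxN opprK.
Qed.

Lemma lambda_min_le A (b : R) v : (0 < n)%N ->
  (forall v w, dot (v *m A) w = dot (w *m A) v) ->
  v != 0 -> dot (v *m A) v <= b * dot v v -> lambda_min A <= b.
Proof.
move=> n0 symA v0 bv; rewrite lambda_minE lerNl; apply: (lambda_max_ge n0 _ v0).
  by move=> x y; rewrite !mulmxN !dotNl symA.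
by rewrite mulmxN dotNl mulNr lerN2.
Qed.

Lemma lambda_min_ge A (b : R) : (0 < n)%N ->
  (forall v w, dot (v *m A) w = dot (w *m A) v) ->
  (forall v, b * dot v v <= dot (v *m A) v) -> b <= lambda_min A.
Proof.
move=> n0 symA bv; rewrite lambda_minE lerNr; apply: (lambda_max_le n0).
  by move=> x y; rewrite !mulmxN !dotNl symA.
by move=> v; rewrite mulmxN dotNl mulNr lerN2.
Qed.

End Rayleigh.

(** * Twice differentiable test functions *)

Section TestFunctions.
Context {R : realType} {n : nat}.
Implicit Types (x y z a : 'rV[R]_n) (f : 'rV[R]_n -> R).

(** The gradient and the Hessian are data, and their regularity is stated entry
    by entry, so that sums and products are covered by the calculus of
    real-valued functions. *)
Definition C2_jet f (g : 'rV[R]_n -> 'rV[R]_n) (H : 'rV[R]_n -> 'M[R]_n) : Prop :=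
  [/\ forall y, is_diff y f (dot (g y)),
      forall i y, is_diff y (fun x => g x 0 i) (fun z => (z *m H y) 0 i) &
      forall i j, continuous (fun y => H y i j)].

Lemma diff_row (g : 'rV[R]_n -> 'rV[R]_n) (A : 'M[R]_n) y :
  (forall i, is_diff y (fun x => g x 0 i) (fun z => (z *m A) 0 i)) ->
  differentiable g y /\ 'd g y = (fun z => z *m A) :> (_ -> _).
Proof.
move=> dg.
have dG : differentiable g y.
  have -> : g = \sum_(i < n) (fun x => g x 0 i *: (delta_mx 0 i : 'rV[R]_n)).
    by apply/funext => x; rewrite fct_sumE -row_sum_delta.
  apply: differentiable_sum => i; apply: differentiableZl.
  by have [] := dg i.
split=> //; apply/funext => z; apply/rowP => i.
have E : dotr (delta_mx 0 i) \o g = (fun x => g x 0 i).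
  by apply/funext => x; exact: dot_delta.
have [_] := is_diff_comp (differentiableP dG) (is_diff_dotr (delta_mx 0 i) (g y)).
by have [_] := dg i; rewrite E => -> /(congr1 (fun h => h z)) /=; rewrite /dotr dot_delta.
Qed.

Lemma C2_jetP f g H : C2_jet f g H ->
  [/\ gradient f = g, hessian f = H & forall A, C2_on A f].
Proof.
move=> [df dg cH].
have gE : gradient f = g.
  apply/funext => y; apply/rowP => i; have [d e] := df y.
  by rewrite mxE deriveE// e dot_delta.
have dG y := diff_row (dg ^~ y).
have HE : hessian f = H.
  apply/funext => y; apply/matrixP => i j.
  rewrite /hessian gE /jacobian mxE (dG y).2.
  by rewrite -rowE mxE.
split=> // A; split=> [y _|y _|].
- by have [] := df y.
- by rewrite gE; exact: (dG y).1.
apply: continuous_subspaceT; rewrite HE => y B [P hP PB].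
have hx : \forall x \near y, forall k : 'I_n * 'I_n, P k.1 k.2 (H x k.1 k.2).
  have hk (k : 'I_n * 'I_n) : nbhs y [set x | P k.1 k.2 (H x k.1 k.2)].
    exact: (cH k.1 k.2 y _ (hP k.1 k.2)).
  exact: (@filter_forall _ _ _ (nbhs y) _ hk).
by apply: filterS hx => x hx; apply: PB => i j; exact: (hx (i, j)).
Qed.

Lemma C2_jet_cst (c : R) : C2_jet (fun=> c) (fun=> 0) (fun=> 0).
Proof.
split=> [y|i y|i j y].
- by apply: is_diff_eq (is_diff_cst c y) _; apply/funext => z; rewrite dot0l.
- rewrite (_ : (fun _ : 'rV_n => _) = cst (0 : R)); last by apply/funext => x; rewrite mxE.
  by apply: is_diff_eq (is_diff_cst _ y) _; apply/funext => z; rewrite mulmx0 mxE.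
- exact: cst_continuous.
Qed.

Lemma C2_jetD f1 g1 H1 f2 g2 H2 : C2_jet f1 g1 H1 -> C2_jet f2 g2 H2 ->
  C2_jet (fun y => f1 y + f2 y) (fun y => g1 y + g2 y) (fun y => H1 y + H2 y).
Proof.
move=> [df1 dg1 c1] [df2 dg2 c2]; split=> [y|i y|i j y].
- apply: is_diff_eq (is_diffD (df1 y) (df2 y)) _.
  by apply/funext => z; rewrite dotDl.
- rewrite (_ : (fun _ : 'rV_n => _) = (fun x => g1 x 0 i) + (fun x => g2 x 0 i)).
    apply: is_diff_eq (is_diffD (dg1 i y) (dg2 i y)) _.
    by apply/funext => z; rewrite mulmxDr [RHS]mxE.
  by apply/funext => x; rewrite mxE.
- rewrite (_ : (fun _ : 'rV_n => _) = (fun x => H1 x i j + H2 x i j)).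
    by apply: continuousD; [exact: c1|exact: c2].
  by apply/funext => x; rewrite mxE.
Qed.

Lemma mulmx_outer (z u v : 'rV[R]_n) : z *m (u^T *m v) = dot u z *: v.
Proof.
rewrite mulmxA; apply/rowP => k; rewrite !mxE big_ord1 !mxE; congr (_ * _).
by apply: eq_bigr => l _; rewrite mxE mulrC.
Qed.

Lemma C2_jetM f1 g1 H1 f2 g2 H2 : C2_jet f1 g1 H1 -> C2_jet f2 g2 H2 ->
  C2_jet (fun y => f1 y * f2 y) (fun y => f1 y *: g2 y + f2 y *: g1 y)
    (fun y => f1 y *: H2 y + f2 y *: H1 y +
              ((g1 y)^T *m g2 y + (g2 y)^T *m g1 y)).
Proof.
move=> [df1 dg1 c1] [df2 dg2 c2].
have cf1 : continuous f1 by move=> y; apply: differentiable_continuous; case: (df1 y).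
have cf2 : continuous f2 by move=> y; apply: differentiable_continuous; case: (df2 y).
have cg1 i : continuous (fun x => g1 x 0 i).
  by move=> y; apply: differentiable_continuous; case: (dg1 i y).
have cg2 i : continuous (fun x => g2 x 0 i).
  by move=> y; apply: differentiable_continuous; case: (dg2 i y).
split=> [y|i y|i j y].
- apply: is_diff_eq (is_diffM (df1 y) (df2 y)) _.
  by apply/funext => z; rewrite dotDl !dotZl.
- rewrite (_ : (fun _ : 'rV_n => _) =
     f1 * (fun x => g2 x 0 i) + f2 * (fun x => g1 x 0 i)).
    apply: is_diff_eq (is_diffD (is_diffM (df1 y) (dg2 i y)) (is_diffM (df2 y) (dg1 i y))) _.
    apply/funext => z.
    rewrite !mulmxDr -!scalemxAr !mulmx_outer.
    rewrite -[LHS]/(f1 y * (z *m H2 y) 0 i + g2 y 0 i * dot (g1 y) z +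
      (f2 y * (z *m H1 y) 0 i + g1 y 0 i * dot (g2 y) z)).
    by rewrite !mxE; ring.
  by apply/funext => x; rewrite !mxE.
- rewrite (_ : (fun _ : 'rV_n => _) = (fun x => f1 x * H2 x i j + f2 x * H1 x i j +
     (g1 x 0 i * g2 x 0 j + g2 x 0 i * g1 x 0 j))); last first.
    by apply/funext => x; rewrite !mxE !big_ord1 !mxE.
  exact: continuousD
    (continuousD (continuousM (cf1 y) (c2 i j y)) (continuousM (cf2 y) (c1 i j y)))
    (continuousD (continuousM (cg1 i y) (cg2 j y)) (continuousM (cg2 i y) (cg1 j y))).
Qed.

Lemma C2_jet_sqdist a :
  C2_jet (fun y => dot (y - a) (y - a)) (fun y => 2 *: (y - a)) (fun=> 2%:M).
Proof.
split=> [y|i y|i j y]; last exact: cst_continuous.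
- rewrite (_ : dot (2 *: (y - a)) = dotr (2 *: (y - a))); last first.
    by apply/funext => z; exact: dotC.
  apply: enorm_is_diff; first exact: dotr_continuous.
  move=> e e0; exists e => // z ze.
  rewrite -[X in `|X|]/(dot (y + z - a) (y + z - a) - dot (y - a) (y - a) -
    dot z (2 *: (y - a))) (addrAC y z); set v := y - a.
  rewrite (_ : _ - _ = dot z z); last by rewrite (dotDl v) !(dotDr v) dotZr (dotC v z); ring.
  by rewrite ger0_norm ?dot_ge0// -enorm_sqr expr2 ler_wpM2r ?enorm_ge0// ltW.
- have E : (fun z : 'rV[R]_n => (z *m (2%:M : 'M[R]_n)) 0 i) = dotr (2 *: delta_mx 0 i).
    by apply/funext => z; rewrite /dotr dotZr dot_delta mul_mx_scalar mxE.
  rewrite E; apply: enorm_is_diff; first exact: dotr_continuous.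
  move=> e e0; exists 1 => // z _.
  rewrite -[X in `|X|]/((2 *: (y + z - a)) 0 i - (2 *: (y - a)) 0 i -
    dot z (2 *: delta_mx 0 i)) dotZr dot_delta !mxE.
  rewrite (_ : _ - _ = 0) ?normr0 ?mulr_ge0 ?enorm_ge0 ?ltW//; ring.
Qed.

(** A cubic in [|y - x0|^2], expanded at its value at [x], to imitate radial
    profiles centred at [x0] without their singularity; the term in [k], flat to
    third order at [x], turns local touching at [x] into global touching. *)
Definition quartic (x0 x : 'rV[R]_n) (c0 c1 c2 c3 k : R) : 'rV[R]_n -> R :=
  fun y => let s := dot (y - x0) (y - x0) - dot (x - x0) (x - x0) in
  let q := dot (y - x) (y - x) in
  c0 + (c1 * s + (c2 * (s * s) + (c3 * (s * s * s) + k * (q * q)))).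

Lemma quarticP (x0 x : 'rV[R]_n) (c0 c1 c2 c3 k : R) :
  let phi := quartic x0 x c0 c1 c2 c3 k in
  [/\ forall A, C2_on A phi, gradient phi x = (2 * c1) *: (x - x0) &
      hessian phi x = (2 * c1)%:M + (8 * c2) *: ((x - x0)^T *m (x - x0))].
Proof.
move=> phi.
have js := C2_jetD (C2_jet_sqdist x0) (C2_jet_cst (- dot (x - x0) (x - x0))).
have jq := C2_jet_sqdist x.
have jss := C2_jetM js js.
have := C2_jetD (C2_jet_cst c0) (C2_jetD (C2_jetM (C2_jet_cst c1) js)
  (C2_jetD (C2_jetM (C2_jet_cst c2) jss) (C2_jetD (C2_jetM (C2_jet_cst c3)
    (C2_jetM jss js)) (C2_jetM (C2_jet_cst k) (C2_jetM jq jq))))).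
move=> /C2_jetP[gE hE c2E]; split; first exact: c2E.
  rewrite gE /= !subrr !dot0l.
  by rewrite !(mul0r, scale0r, scaler0, addr0, add0r) scalerA mulrC.
rewrite hE /= !subrr !dot0l !trmx0 !mul0mx !mulmx0.
rewrite !(mul0r, scale0r, scaler0, addr0, add0r, trmx0, mul0mx, mulmx0).
rewrite scale_scalar_mx mulrC; congr (_ + _).
have -> (u : 'rV[R]_n) : (2 *: u)^T *m (2 *: u) = (2 * 2) *: (u^T *m u).
  by rewrite [(2 *: u)^T]linearZ /= -scalemxAl -scalemxAr scalerA.
by rewrite -scalerDl scalerA; congr (_ *: _); ring.
Qed.

End TestFunctions.

(** * Radial viscosity tests *)

Section RadialTests.
Context {R : realType} {n : nat} (n_gt0 : (0 < n)%N).
Variables (Omega : set 'rV[R]_n) (u : 'rV[R]_n -> R).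
Implicit Types (x y z : 'rV[R]_n) (b k r : R).

(** The difference of the two sides is [s0 h^4 ((h + 3)^2 + 1) / 16] where
    [s = s0 (1 + h)]. Third order makes it a majorant of the distance [s] by
    a polynomial in [s^2] which agrees with it to second order. *)
Lemma cubic_majorant (s s0 d : R) : 0 < s0 -> d = s ^+ 2 - s0 ^+ 2 ->
  s - s0 <= d / (2 * s0) - d * d / (8 * s0 ^+ 3) + d * d * d / (16 * s0 ^+ 5).
Proof.
move=> s00 dE; rewrite -subr_ge0.
have -> : d / (2 * s0) - d * d / (8 * s0 ^+ 3) + d * d * d / (16 * s0 ^+ 5) - (s - s0)
  = s0 * (((s - s0) / s0) ^+ 4 * (((s - s0) / s0 + 3) ^+ 2 + 1) / 16).
  by rewrite dE; field; rewrite lt0r_neq0.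
have h4 : 0 <= ((s - s0) / s0) ^+ 4.
  by rewrite exprn_even_ge0.
apply: mulr_ge0; first exact: ltW.
by rewrite divr_ge0// mulr_ge0// addr_ge0// sqr_ge0.
Qed.

Lemma inf_laplacian_quartic x0 x c0 c1 c2 c3 k :
  let z := x - x0 in z != 0 -> c1 != 0 ->
  (gradient (quartic x0 x c0 c1 c2 c3 k) x != 0) /\
  inf_laplacian (quartic x0 x c0 c1 c2 c3 k) x = 2 * c1 + 8 * c2 * dot z z.
Proof.
move=> z z0 c10; have [_ gE hE] := @quarticP R n x0 x c0 c1 c2 c3 k.
have a0 : 2 * c1 != 0 by rewrite mulf_neq0// pnatr_eq0.
rewrite /inf_laplacian gE hE enorm_sqr; move: z0; rewrite /z.
move: (x - x0) => {}z z0; split.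
  by rewrite scaler_eq0 negb_or a0.
rewrite mulmxDr mul_mx_scalar -scalemxAr -!scalemxAl.
rewrite mulmx_outer !dotE; have : dot z z != 0 by rewrite dot_eq0.
by move: a0; set a := 2 * c1 => a0; move: (dot z z) => q q0; field; rewrite q0 a0.
Qed.

(** The profile [b s - k s^2/2] of [s = |y - x0|] satisfies the equation with
    right-hand side [k] wherever its gradient does not vanish. It is replaced by
    a quartic majorant, and the bounds [B], [D] on the domain make the quartic
    term dominate away from [x]. At a critical point of the profile the largest
    eigenvalue could be [0], which is why [b != k |x - x0|] is required. *)
Lemma subsolution_radial x0 x b k r (B D : R) :
  viscosity_subsolution Omega u -> Omega x ->
  (forall y, Omega y -> u y <= B) -> (forall y, Omega y -> enorm (y - x0) <= D) ->
  x != x0 -> 0 <= b -> 0 <= k -> b != k * enorm (x - x0) -> 0 < r ->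
  (forall y, Omega y -> enorm (y - x) < r ->
     u y <= u x + (b * enorm (y - x0) - k / 2 * enorm (y - x0) ^+ 2) -
                  (b * enorm (x - x0) - k / 2 * enorm (x - x0) ^+ 2)) ->
  k <= 1.
Proof.
move=> [_ usub] Ox uB D0 xx0 b0 k0 bk r0 hu.
set s0 := enorm (x - x0); have s00 : 0 < s0 by rewrite enorm_gt0 subr_eq0.
pose qx := b * s0 - k / 2 * s0 ^+ 2.
pose K := (`|B| + `|u x| + `|qx| + k / 2 * D ^+ 2) / r ^+ 4.
have K0 : 0 <= K.
  by rewrite divr_ge0 ?exprn_ge0 ?(ltW r0)// !addr_ge0// mulr_ge0 ?sqr_ge0// divr_ge0.
pose c1 := b / (2 * s0) - k / 2; pose c2 := - (b / (8 * s0 ^+ 3)).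
pose c3 := b / (16 * s0 ^+ 5).
have s0N : s0 != 0 by rewrite lt0r_neq0.
pose phi := quartic x0 x (u x) c1 c2 c3 K.
have hphi y : u x + (b * enorm (y - x0) - k / 2 * enorm (y - x0) ^+ 2) - qx +
    K * enorm (y - x) ^+ 4 <= phi y.
  rewrite /phi /quartic -!enorm_sqr -/s0; set s := enorm (y - x0).
  have := ler_wpM2l b0 (cubic_majorant s00 (erefl (s ^+ 2 - s0 ^+ 2))).
  rewrite /qx /c1 /c2 /c3; set d := s ^+ 2 - s0 ^+ 2.
  rewrite -subr_ge0 => h; rewrite -subr_ge0; move: h; congr (0 <= _).
  by rewrite /d; field.
have xz : x - x0 != 0 by rewrite subr_eq0.
have c1N : c1 != 0.
  apply: contra bk; rewrite /c1 subr_eq0 => /eqP e; apply/eqP.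
  have -> : b = (b / (2 * s0)) * (2 * s0) by field.
  by rewrite e -/s0; field.
have [gN lapE] := @inf_laplacian_quartic x0 x (u x) c1 c2 c3 K xz c1N.
have [c2phi _ _] := @quarticP R n x0 x (u x) c1 c2 c3 K.
have := usub x phi Ox (c2phi _); rewrite /inf_laplacian_sup gN lapE -enorm_sqr -/s0.
have -> : - (2 * c1 + 8 * c2 * s0 ^+ 2) = k by rewrite /c1 /c2; field.
apply; split.
  by rewrite /phi /quartic !subrr !dot0l !mulr0 !addr0.
move=> y Oy; apply: le_trans (hphi y).
have [yr|yr] := ltP (enorm (y - x)) r.
  rewrite (le_trans (hu _ Oy yr))// /qx -/s0 lerDl; apply: mulr_ge0 => //.
  by apply: exprn_ge0; exact: enorm_ge0.
have hK : `|B| + `|u x| + `|qx| + k / 2 * D ^+ 2 <= K * enorm (y - x) ^+ 4.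
  rewrite -[leLHS](@divfK _ (r ^+ 4)) ?lt0r_neq0 ?exprn_gt0// -/K.
  by rewrite ler_wpM2l// ler_pXn2r// ?nnegrE ?enorm_ge0// ?(ltW r0).
have kD : k / 2 * enorm (y - x0) ^+ 2 <= k / 2 * D ^+ 2.
  rewrite ler_wpM2l ?divr_ge0// ler_pXn2r// ?nnegrE ?enorm_ge0//.
    exact: D0.
  exact: le_trans (enorm_ge0 _) (D0 _ Oy).
have bs : 0 <= b * enorm (y - x0) by rewrite mulr_ge0 ?enorm_ge0.
have := uB _ Oy; have := ler_norm B; have := ler_norm qx.
have := ler_norm (- u x); rewrite normrN; lra.
Qed.

(** Mirror image of the previous lemma. Critical points are harmless here: the
    profile [- b s - k s^2/2] has one only at the centre with [b = 0], where its
    Hessian is [- k I]. *)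
Lemma supersolution_radial x0 x b k r (B : R) :
  viscosity_supersolution Omega u -> Omega x ->
  (forall y, Omega y -> B <= u y) ->
  b = 0 \/ x != x0 -> 0 <= b -> 0 < k -> 0 < r ->
  (forall y, Omega y -> enorm (y - x) < r ->
     u x - (b * enorm (y - x0) + k / 2 * enorm (y - x0) ^+ 2) +
           (b * enorm (x - x0) + k / 2 * enorm (x - x0) ^+ 2) <= u y) ->
  1 <= k.
Proof.
move=> [_ usup] Ox uB xx0 b0 k0 r0 hu.
set s0 := enorm (x - x0); have s00 : 0 <= s0 by rewrite enorm_ge0.
pose qx := b * s0 + k / 2 * s0 ^+ 2.
pose K := (`|B| + `|u x| + `|qx|) / r ^+ 4.
have K0 : 0 <= K by rewrite divr_ge0 ?exprn_ge0 ?(ltW r0)// !addr_ge0.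
pose c1 := - (b / (2 * s0)) - k / 2; pose c2 := b / (8 * s0 ^+ 3).
pose c3 := - (b / (16 * s0 ^+ 5)).
pose phi := quartic x0 x (u x) c1 c2 c3 (- K).
have hphi y : phi y <= u x - (b * enorm (y - x0) + k / 2 * enorm (y - x0) ^+ 2) + qx -
    K * enorm (y - x) ^+ 4.
  rewrite /phi /quartic -!enorm_sqr -/s0; set s := enorm (y - x0).
  have [b00|b_neq0] := eqVneq b 0.
    by rewrite /qx /c1 /c2 /c3 b00 !mul0r !oppr0; lra.
  have s0_gt0 : 0 < s0.
    by case: xx0 => [b00|xx0]; [rewrite b00 eqxx in b_neq0|rewrite enorm_gt0 subr_eq0].
  have s0N : s0 != 0 by rewrite lt0r_neq0.
  have := ler_wpM2l b0 (cubic_majorant s0_gt0 (erefl (s ^+ 2 - s0 ^+ 2))).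
  rewrite /qx /c1 /c2 /c3; set d := s ^+ 2 - s0 ^+ 2.
  rewrite -subr_ge0 => h; rewrite -subr_ge0; move: h; congr (0 <= _).
  by rewrite /d; field.
have pphi : prec_at Omega x phi u.
  split.
    by rewrite /phi /quartic !subrr !dot0l !mulr0 !addr0.
  move=> y Oy; apply: le_trans (hphi y) _.
  have [yr|yr] := ltP (enorm (y - x)) r.
    rewrite (le_trans _ (hu _ Oy yr))// /qx -/s0 gerBl; apply: mulr_ge0 => //.
    by apply: exprn_ge0; exact: enorm_ge0.
  have hK : `|B| + `|u x| + `|qx| <= K * enorm (y - x) ^+ 4.
    rewrite -[leLHS](@divfK _ (r ^+ 4)) ?lt0r_neq0 ?exprn_gt0// -/K.
    by rewrite ler_wpM2l// ler_pXn2r// ?nnegrE ?enorm_ge0// ?(ltW r0).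
  have bs : 0 <= b * enorm (y - x0) by rewrite mulr_ge0 ?enorm_ge0.
  have ks : 0 <= k / 2 * enorm (y - x0) ^+ 2 by rewrite mulr_ge0 ?sqr_ge0 ?divr_ge0 ?(ltW k0).
  have := uB _ Oy; have := ler_norm (- B); have := ler_norm qx.
  have := ler_norm (u x); rewrite normrN; lra.
have [c2phi gE hE] := @quarticP R n x0 x (u x) c1 c2 c3 (- K).
have := usup x phi Ox (c2phi _) pphi; rewrite /inf_laplacian_inf.
have [/eqP|xz] := boolP (x - x0 == 0).
  move=> xz; have b00 : b = 0.
    by case: xx0 => // /negP[]; rewrite -subr_eq0 xz.
  rewrite /phi gE xz scaler0 eqxx /= => /le_trans; apply.
  rewrite lerNl; apply: (lambda_min_ge n_gt0); rewrite hE xz mulmx0 scaler0 addr0.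
    by move=> v w; rewrite !mul_mx_scalar !dotZl dotC.
  by move=> v; rewrite mul_mx_scalar dotZl /c1 b00 mul0r oppr0 add0r; lra.
have s0_gt0 : 0 < s0 by rewrite enorm_gt0.
have s0N : s0 != 0 by rewrite lt0r_neq0.
have c1N : c1 != 0.
  rewrite /c1 -opprD oppr_eq0 lt0r_neq0// ltr_wpDl ?divr_gt0// divr_ge0// mulr_ge0//.
have [gN lapE] := @inf_laplacian_quartic x0 x (u x) c1 c2 c3 (- K) xz c1N.
rewrite /phi gN lapE -enorm_sqr -/s0.
by have -> : - (2 * c1 + 8 * c2 * s0 ^+ 2) = k by rewrite /c1 /c2; field.
Qed.

End RadialTests.

(** * Projection on a compact convex set *)

Lemma continuous_lsc_on (R : realType) (n : nat) (A : set 'rV[R]_n) (f : 'rV[R]_n -> R) :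
  continuous f -> lsc_on A f.
Proof.
move=> cf x a; rewrite lte_fin => ax.
have h : {within A, continuous f} by exact: continuous_subspaceT.
exists [set y : subspace A | a < f y] => //; exact: (cvgr_gt _ (h x)).
Qed.

Section Projection.
Context {R : realType} {n : nat}.
Variable M : set 'rV[R]_n.
Hypotheses (M_neq0 : M !=set0) (M_compact : compact M)
  (M_convex : forall x y (t : R), M x -> M y -> 0 <= t -> t <= 1 ->
     M (x + t *: (y - x))).
Implicit Types x y z q : 'rV[R]_n.

Definition proj x : 'rV[R]_n :=
  xget 0 [set p | M p /\ forall q, M q -> enorm (x - p) <= enorm (x - q)].

Lemma projP x : M (proj x) /\ forall q, M q -> enorm (x - proj x) <= enorm (x - q).
Proof.
rewrite /proj; case: xgetP => [p _ //|/= noP].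
have [|p /set_mem Mp hp] := compact_EVT_min (f := fun q => enorm (q - x)) M_neq0 M_compact.
  exact/continuous_subspaceT/edist_continuous.
case: (noP p); split=> // q Mq.
by rewrite enorm_distC (enorm_distC x); apply/hp/mem_set.
Qed.

Lemma proj_obtuse x q : M q -> dot (x - proj x) (q - proj x) <= 0.
Proof.
have [Mp hp] := projP x; set p := proj x in Mp hp *; move=> Mq.
rewrite leNgt; apply/negP => a0.
set a := dot _ _ in a0; set w := q - p.
pose t := Num.min 1 (a / (dot w w + 1)).
have w0 : 0 < dot w w + 1 by rewrite ltr_wpDl ?dot_ge0.
have t0 : 0 < t by rewrite lt_min ltr01 divr_gt0.
have t1 : t <= 1 by rewrite ge_min lexx.
have ta : t * dot w w <= a.
  apply: (@le_trans _ _ (t * (dot w w + 1))); first by rewrite ler_pM2l// lerDl.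
  by rewrite -ler_pdivlMr// ge_min lexx orbT.
have := hp _ (M_convex Mp Mq (ltW t0) t1); rewrite -/w.
rewrite enorm_leP ?enorm_ge0// enorm_sqr opprD addrA => h.
have : 0 <= t * (t * dot w w - 2 * a).
  move: h; rewrite !(dotBl _ (t *: w)) !(dotBr _ (t *: w)) !dotZl !dotZr.
  rewrite (dotC w (x - p)) -/a; lra.
rewrite pmulr_rge0//; lra.
Qed.

Lemma proj_nonexpansive x y : enorm (proj x - proj y) <= enorm (x - y).
Proof.
have [Mx _] := projP x; have [My _] := projP y.
have := proj_obtuse x My; have := proj_obtuse y Mx.
move: (proj x) (proj y) => a b h1 h2.
have [->|ab] := eqVneq (enorm (a - b)) 0; first exact: enorm_ge0.
have ab0 : 0 < enorm (a - b) by rewrite lt0r ab enorm_ge0.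
rewrite -(ler_pM2r ab0); apply: le_trans (cauchy_schwarz _ _).
rewrite -expr2 enorm_sqr -subr_ge0.
have -> : dot (x - y) (a - b) - dot (a - b) (a - b)
    = - (dot (x - a) (b - a) + dot (y - b) (a - b)) by rewrite !dotE; ring.
by rewrite oppr_ge0; lra.
Qed.

(** When [M] is the ridge of a stadium-like domain and [c] its inradius, this is
    the solution; it is defined and differentiable everywhere. *)
Definition paraboloid (c : R) y := c ^+ 2 / 2 - dot (y - proj y) (y - proj y) / 2.

(** Comparing [x + z] with the projection of [x] gives the lower bound; the
    upper bound holds because [proj (x + z) - proj x] makes an obtuse angle with
    [x - proj x]. *)
Lemma paraboloid_expansion c x z :
  - (dot z z / 2) <= paraboloid c (x + z) - paraboloid c x - dot z (proj x - x) <= 0.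
Proof.
rewrite /paraboloid; have [Mq hq] := projP (x + z); have [Mp _] := projP x.
have := proj_obtuse x Mq; have := hq _ Mp.
rewrite enorm_leP ?enorm_ge0// enorm_sqr.
set p := proj x; set q := proj (x + z).
rewrite (_ : x + z - q = (x - p) + z - (q - p)); last by apply/rowP => i; rewrite !mxE; ring.
rewrite (_ : x + z - p = (x - p) + z); last by apply/rowP => i; rewrite !mxE; ring.
rewrite -(opprB x p); move: (x - p) (q - p) => v w.
have := dot_ge0 (z - w); rewrite !dotE (dotC z v) (dotC w v) (dotC w z) => h3 h1 h2.
apply/andP; split; lra.
Qed.

Lemma paraboloid_is_diff c x :
  is_diff x (paraboloid c) (dotr (proj x - x)).
Proof.
apply: enorm_is_diff; first exact: dotr_continuous.
move=> e e0; exists (2 * e) => [|z ze]; first by rewrite mulr_gt0.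
have /andP[h1 h2] := paraboloid_expansion c x z.
rewrite -[X in `|X|]/(paraboloid c (x + z) - paraboloid c x - dot z (proj x - x)).
rewrite ler0_norm// lerNl (le_trans _ h1)// lerN2 -enorm_sqr expr2.
rewrite ler_pdivrMr// mulrAC; apply: ler_wpM2r; first exact: enorm_ge0.
by move: ze {h1 h2}; lra.
Qed.

Lemma paraboloid_gradient c x :
  differentiable (paraboloid c) x /\ gradient (paraboloid c) x = proj x - x.
Proof.
have [df e] := paraboloid_is_diff c x; split=> //.
by apply/rowP => i; rewrite mxE deriveE// e /dotr dotC dot_delta.
Qed.

Lemma paraboloid_continuous c : continuous (paraboloid c).
Proof. by move=> x; apply: differentiable_continuous; case: (paraboloid_gradient c x). Qed.

Lemma proj_sub_lipschitz x y :
  enorm ((proj x - x) - (proj y - y)) <= 2 * enorm (x - y).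
Proof.
rewrite (_ : _ - _ = (proj x - proj y) + (y - x)); last first.
  by apply/rowP => i; rewrite !mxE; ring.
rewrite (le_trans (enormD _ _))// (enorm_distC y).
have := proj_nonexpansive x y; lra.
Qed.

Lemma touching_gradient_above (Omega : set 'rV[R]_n) c phi x : open Omega -> Omega x ->
  C2_on Omega phi -> prec_at Omega x (paraboloid c) phi ->
  gradient phi x = proj x - x.
Proof.
move=> oO Ox [dphi _ _] [e h]; apply/eqP; rewrite -subr_eq0 -dot_eq0 eq_le dot_ge0 andbT.
set g := proj x - x; set z := - (gradient phi x - g).
have [r r0 hr] := open_segment z oO Ox.
have : dot g z <= dot (gradient phi x) z.
  apply: (@gradient_ge _ _ _ _ _ _ (- (dot z z / 2)) r) => // [|t t0 tr]; first exact: dphi.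
  have := h _ (hr t _); rewrite (gtr0_norm t0) => /(_ tr); apply: le_trans.
  have /andP[+ _] := paraboloid_expansion c x (t *: z).
  rewrite !dotZl dotZr -e -/g (dotC z g).
  by move: (paraboloid c _) (paraboloid c _) (dot _ _) (dot _ _) => *; lra.
by rewrite -subr_ge0 -dotBl {1}/z dotNr oppr_ge0.
Qed.

Lemma touching_gradient_below (Omega : set 'rV[R]_n) c phi x : open Omega -> Omega x ->
  C2_on Omega phi -> prec_at Omega x phi (paraboloid c) ->
  gradient phi x = proj x - x.
Proof.
move=> oO Ox [dphi _ _] [e h]; apply/eqP; rewrite -subr_eq0 -dot_eq0 eq_le dot_ge0 andbT.
set g := proj x - x; set z := gradient phi x - g.
have [r r0 hr] := open_segment z oO Ox.
have : dot (gradient phi x) z <= dot g z.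
  apply: (@gradient_le _ _ _ _ _ _ 0 r) => // [|t t0 tr]; first exact: dphi.
  have := h _ (hr t _); rewrite (gtr0_norm t0) => /(_ tr) /le_trans; apply.
  have /andP[_] := paraboloid_expansion c x (t *: z).
  rewrite !dotZl e -/g (dotC z g).
  by move: (paraboloid c _) (paraboloid c _) (dot _ _) => *; lra.
by rewrite -subr_le0 -dotBl.
Qed.

(** A function touching from above at [x] also lies above the smooth paraboloid
    [c^2/2 - |y - proj x|^2/2], whose Hessian is [- I]. *)
Lemma paraboloid_subsolution (Omega : set 'rV[R]_n) c : (0 < n)%N -> open Omega ->
  viscosity_subsolution Omega (paraboloid c).
Proof.
move=> n0 oO; split.
  by apply: continuous_lsc_on => y; exact: (continuousN (@paraboloid_continuous c y)).
move=> x phi Ox Cphi touch.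
have gE := touching_gradient_above oO Ox Cphi touch.
have H z : - dot z z <= dot (z *m hessian phi x) z.
  have [r r0 hr] := open_segment z oO Ox.
  apply: (@hessian_ge _ _ _ _ _ _ _ r oO Ox Cphi r0) => t t0 tr.
  have [e h] := touch; have := h _ (hr t _); rewrite (gtr0_norm t0) => /(_ tr).
  apply: le_trans; have /andP[+ _] := paraboloid_expansion c x (t *: z).
  rewrite !dotZl dotZr -e gE (dotC z (_ - _)).
  by move: (paraboloid c _) (paraboloid c _) (dot _ _) (dot _ _) => *; lra.
rewrite lerNl /inf_laplacian_sup; case: ifPn => [g0|_].
  rewrite /inf_laplacian enorm_sqr ler_pdivlMl ?dot_gt0//.
  by have := H (gradient phi x); lra.
apply: (@lambda_max_ge _ _ _ _ (delta_mx 0 (Ordinal n0))) => //.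
- by move=> v w; exact: hessian_sym oO Ox Cphi.
- by rewrite -dot_eq0 dot_delta mxE !eqxx oner_eq0.
- by rewrite mulN1r; exact: H.
Qed.

End Projection.

(** * Convex domains, distance to the frontier and high ridge *)

Section ConvexDomain.
Context {R : realType} {n : nat}.
Implicit Types (x y z p : 'rV[R]_n) (r t : R).

Lemma eball_compact x r : compact [set y | enorm (y - x) <= r].
Proof.
apply: bounded_closed_compact.
  apply: (@enorm_bounded_set _ _ _ (r + enorm x)) => v /= h.
  have := enormD (v - x) x; rewrite subrK; lra.
rewrite (_ : [set y | _] = (fun v => enorm (v - x)) @^-1` [set s : R | s <= r])//.
apply: preimage_closed; last exact: closed_le.
by move=> v _; apply: edist_continuous.
Qed.

Lemma convex_segment (A : set 'rV[R]_n) x y t : convex A -> A x -> A y ->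
  0 <= t -> t <= 1 -> A (x + t *: (y - x)).
Proof.
move=> cA Ax Ay t0 t1.
pose l : {i01 R} := Itv01 t0 t1.
have := cA y x l (mem_set Ay) (mem_set Ax) => /set_mem.
have -> : x + t *: (y - x) = t *: y + (1 - t) *: x.
  by rewrite scalerBr scalerBl scale1r addrCA addrA.
exact.
Qed.

Section Domain.
Variable Omega : set 'rV[R]_n.
Hypotheses (n_gt0 : (0 < n)%N) (Omega_neq0 : Omega !=set0)
  (Omega_open : open Omega) (Omega_bounded : bounded_set Omega)
  (Omega_convex : convex Omega).

Local Notation d := (bdist Omega).
Local Notation K := (closure Omega).
Local Notation rho := (inradius Omega).
Local Notation M := (high_ridge Omega).

Lemma Omega_enorm_bounded : exists D : R, forall x, K x -> enorm x <= D.
Proof.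
have [D [_ hD]] := Omega_bounded.
exists (n.+1%:R * (D + 1) + 1) => x /closure_enormP/(_ 1 ltr01)[y Oy yx].
have ynorm : `|y| <= D + 1 by apply: (hD (D + 1)) => //; rewrite ltrDl.
have ey : enorm y <= n.+1%:R * (D + 1).
  by rewrite (le_trans (enorm_le_norm y))// ler_wpM2l.
have := enormD (x - y) y; rewrite subrK enorm_distC; lra.
Qed.

Lemma compact_closure : compact K.
Proof.
apply: bounded_closed_compact; last exact: closed_closure.
by have [D hD] := Omega_enorm_bounded; exact: enorm_bounded_set hD.
Qed.

Lemma frontierE x : frontier Omega x <-> K x /\ ~ Omega x.
Proof. by rewrite /frontier; have /interior_id -> := Omega_open. Qed.

Lemma frontier_out x : frontier Omega x -> ~ Omega x.
Proof. by move=> /frontierE[]. Qed.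

Lemma frontier_closure x : frontier Omega x -> K x.
Proof. by move=> /frontierE[]. Qed.

Lemma Omega_closure x : Omega x -> K x.
Proof. exact: subset_closure. Qed.

Lemma closure_split x : K x -> Omega x \/ frontier Omega x.
Proof.
by move=> Kx; have [Ox|Ox] := pselect (Omega x); [left|right; apply/frontierE].
Qed.

Lemma compact_frontier : compact (frontier Omega).
Proof.
apply: (@subclosed_compact _ _ K); last by move=> x /frontier_closure.
- apply: closedI; [exact: closed_closure|apply: open_closedC; exact: open_interior].
- exact: compact_closure.
Qed.

(** The first exit time is a minimum over a compact set of times. *)
Lemma exit_point x y : Omega x -> ~ Omega y ->
  exists t, [/\ 0 < t, t <= 1 & frontier Omega (x + t *: (y - x))].
Proof.
move=> Ox Oy; pose T := `[0, 1]%classic `&` (fun t => x + t *: (y - x)) @^-1` (~` Omega).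
have cl : continuous (fun t : R => x + t *: (y - x)).
  by move=> t; apply: cvgD; [exact: cvg_cst|exact: scalel_continuous].
have cT : compact T.
  apply: compact_closedI; first exact: segment_compact.
  apply: preimage_closed; last exact: open_closedC.
  by move=> v _; apply: cl.
have T0 : T !=set0.
  by exists 1; split; [rewrite /= in_itv/= ler01 lexx|rewrite /= scale1r addrC subrK].
have [|t /set_mem[]] := compact_EVT_min (f := id) T0 cT.
  by apply: continuous_subspaceT => z; exact: cvg_id.
rewrite /= in_itv/= => /andP[t0 t1] Ot ht.
have t_gt0 : 0 < t.
  rewrite lt0r t0 andbT; apply/negP => /eqP te.
  by apply: Ot; rewrite te scale0r addr0.
exists t; split=> //; apply/frontierE; split=> //.
apply/closure_enormP => r r0.
pose c := enorm (y - x) + 1; have c0 : 0 < c by rewrite ltr_wpDl// enorm_ge0.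
pose e := Num.min t (r / c / 2).
have rc : 0 < r / c by rewrite divr_gt0.
have e0 : 0 < e by rewrite lt_min t_gt0 divr_gt0.
exists (x + (t - e) *: (y - x)).
  apply: contrapT => hO.
  have : T (t - e).
    split=> //; rewrite /= in_itv/= subr_ge0 ge_min lexx/=; lra.
  by move=> /mem_set/ht; rewrite leNgt ltrBlDr ltrDl e0.
rewrite opprD addrACA subrr add0r -scalerBl enormZ addrAC subrr sub0r normrN gtr0_norm//.
have ec : e * c < r.
  rewrite -ltr_pdivlMr// (@le_lt_trans _ _ (r / c / 2))//; last by lra.
  by rewrite ge_min lexx orbT.
by apply: le_lt_trans ec; rewrite ler_wpM2l ?(ltW e0)// lerDl.
Qed.

Lemma frontier_neq0 : frontier Omega !=set0.
Proof.
have [x Ox] := Omega_neq0; have [D hD] := Omega_enorm_bounded.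
pose e : 'rV[R]_n := delta_mx 0 (Ordinal n_gt0).
have ee : enorm e = 1.
  by rewrite /enorm dot_delta mxE !eqxx sqrtr1.
have Oy : ~ Omega ((`|D| + 1) *: e).
  move=> /Omega_closure/hD; rewrite enormZ ee mulr1 ger0_norm ?addr_ge0//.
  by have := ler_norm D; lra.
by have [t [_ _ h]] := exit_point Ox Oy; exists (x + t *: ((`|D| + 1) *: e - x)).
Qed.

Lemma bdist_le x p : frontier Omega p -> d x <= enorm (x - p).
Proof.
move=> fp; apply: ge_inf; last by exists p.
by exists 0 => _ [q _ <-]; exact: enorm_ge0.
Qed.

Lemma bdist_attained x : exists2 p, frontier Omega p & enorm (x - p) = d x.
Proof.
have [|p /set_mem fp hp] := compact_EVT_min (f := fun p => enorm (p - x)) frontier_neq0 compact_frontier.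
  exact/continuous_subspaceT/edist_continuous.
exists p => //; apply/eqP; rewrite eq_le bdist_le// andbT.
apply: lb_le_inf; first by exists (enorm (x - p)); exists p.
by move=> _ [q fq <-]; rewrite enorm_distC (enorm_distC x); apply/hp/mem_set.
Qed.

Lemma bdist_ge0 x : 0 <= d x.
Proof. by have [p _ <-] := bdist_attained x; exact: enorm_ge0. Qed.

Lemma bdist_frontier x : frontier Omega x -> d x = 0.
Proof.
move=> fx; apply/eqP; rewrite eq_le bdist_ge0 andbT.
by have := bdist_le x fx; rewrite subrr enorm0.
Qed.

Lemma bdist_gt0 x : Omega x -> 0 < d x.
Proof.
move=> Ox; have [p fp <-] := bdist_attained x; rewrite enorm_gt0 subr_eq0.
by apply/negP => /eqP xp; apply: (frontier_out fp); rewrite -xp.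
Qed.

Lemma bdist_gt0_Omega x : K x -> 0 < d x -> Omega x.
Proof. by move=> /closure_split[//|/bdist_frontier ->]; rewrite ltxx. Qed.

Lemma bdist_triangle x y : d x <= d y + enorm (x - y).
Proof.
have [p fp <-] := bdist_attained y; rewrite (le_trans (bdist_le x fp))//.
by rewrite [leRHS]addrC enorm_triangle.
Qed.

Lemma bdist_lipschitz x y : `|d x - d y| <= 1 * enorm (x - y).
Proof.
rewrite mul1r ler_norml; have := bdist_triangle x y; have := bdist_triangle y x.
by rewrite (enorm_distC y) => h1 h2; apply/andP; split; lra.
Qed.

Lemma bdist_continuous : continuous d.
Proof. exact: lipschitz_continuous bdist_lipschitz. Qed.

Lemma bdist_ball x y : Omega x -> enorm (y - x) < d x -> Omega y.
Proof.
move=> Ox yx; apply: contrapT => Oy.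
have [t [t0 t1 /(bdist_le x)]] := exit_point Ox Oy.
rewrite opprD addrA subrr sub0r enormN enormZ gtr0_norm//.
have := ler_wpM2r (enorm_ge0 (y - x)) t1; lra.
Qed.

Lemma inradius_attained : exists2 x, K x & d x = rho /\ forall y, K y -> d y <= rho.
Proof.
have K0 : K !=set0 by have [x /Omega_closure] := Omega_neq0; exists x.
have [|x /set_mem Kx hx] := compact_EVT_max (f := d) K0 compact_closure.
  exact/continuous_subspaceT/bdist_continuous.
have E : d x = rho.
  apply/eqP; rewrite eq_le; apply/andP; split.
    apply: ub_le_sup; last by exists x.
    by exists (d x) => _ [y Ky <-]; apply/hx/mem_set.
  apply: ge_sup; first by exists (d x); exists x.
  by move=> _ [y Ky <-]; apply/hx/mem_set.
by exists x => //; split=> // y Ky; rewrite -E; apply/hx/mem_set.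
Qed.

Lemma bdist_le_inradius x : K x -> d x <= rho.
Proof. by move=> Kx; have [_ _ [_]] := inradius_attained; exact. Qed.

Lemma inradius_gt0 : 0 < rho.
Proof.
have [x Ox] := Omega_neq0.
by rewrite (lt_le_trans (bdist_gt0 Ox))// bdist_le_inradius//; exact: Omega_closure.
Qed.

Lemma ridge_Omega x : M x -> Omega x.
Proof. by move=> [Kx dx]; apply: bdist_gt0_Omega => //; rewrite dx inradius_gt0. Qed.

Lemma ridge_neq0 : M !=set0.
Proof. by have [x Kx [dx _]] := inradius_attained; exists x; split. Qed.

Lemma ridge_closed : closed M.
Proof.
apply: closedI; first exact: closed_closure.
rewrite (_ : (fun x => _) = d @^-1` [set rho])//.
by apply: preimage_closed; [move=> x _; exact: bdist_continuous|exact: closed_eq].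
Qed.

Lemma ridge_compact : compact M.
Proof.
apply: (subclosed_compact ridge_closed compact_closure).
by move=> x [].
Qed.

(** Translate the two open balls of radius [rho]: the ball around an
    intermediate centre consists of convex combinations of their points. *)
Lemma ridge_segment x y t : M x -> M y -> 0 <= t -> t <= 1 -> M (x + t *: (y - x)).
Proof.
move=> Mx My t0 t1; set m := x + _.
have Om : Omega m by apply: convex_segment => //; exact: ridge_Omega.
split; first exact: Omega_closure.
apply/eqP; rewrite eq_le bdist_le_inradius/=; last exact: Omega_closure.
have [p fp <-] := bdist_attained m; rewrite leNgt; apply/negP => hp.
apply: (frontier_out fp).
have Mball z : M z -> Omega (z + (p - m)).
  move=> Mz; apply: (bdist_ball (ridge_Omega Mz)); rewrite addrC addKr.
  by rewrite enorm_distC; case: Mz => _ ->.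
have -> : p = (x + (p - m)) + t *: ((y + (p - m)) - (x + (p - m))).
  by apply/rowP => i; rewrite /m !mxE; ring.
by apply: convex_segment => //; exact: Mball.
Qed.

(** * A solution on stadium-like domains *)

Local Notation pr := (proj M).

Lemma ridge_projP x : M (pr x) /\ forall q, M q -> enorm (x - pr x) <= enorm (x - q).
Proof. by apply: projP; [exact: ridge_neq0|exact: ridge_compact]. Qed.

Lemma bdist_toward x p t : frontier Omega p -> enorm (x - p) = d x ->
  0 <= t -> t <= 1 -> d (x + t *: (p - x)) <= (1 - t) * d x.
Proof.
move=> fp ep t0 t1; apply: (le_trans (bdist_le _ fp)).
rewrite (_ : _ - p = (1 - t) *: (x - p)); last by apply/rowP => i; rewrite !mxE; ring.
by rewrite enormZ ger0_norm ?subr_ge0// ep.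
Qed.

Lemma bdist_gradient x p : differentiable d x -> frontier Omega p ->
  enorm (x - p) = d x -> dot (gradient d x) (p - x) <= - d x.
Proof.
move=> dd fp ep; apply: (@gradient_le _ _ _ _ _ _ 0 1) => // t t0 t1.
have := bdist_toward fp ep (ltW t0) (ltW t1); lra.
Qed.

(** At a maximum point of [d - (1 - e)|y - x0|] off the ridge, the slope of [d]
    would be at most [1 - e], while moving away from a nearest frontier point
    increases [d] at rate one. Hence such maximum points lie on the ridge. *)
Lemma ridge_at_distance x0 : (forall x, Omega x -> ~ M x -> differentiable d x) ->
  Omega x0 -> enorm (x0 - pr x0) <= rho - d x0.
Proof.
move=> dd Ox0; set L := enorm (x0 - pr x0).
have L0 : 0 <= L by exact: enorm_ge0.
suff key (e : R) : 0 < e -> e < 1 -> (1 - e) * L <= rho - d x0.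
  apply/ler_addgt0Pr => e e0.
  pose e' := Num.min (1 / 2) (e / (L + 1)).
  have L1 : 0 < L + 1 by rewrite ltr_wpDl.
  have e'0 : 0 < e' by rewrite lt_min !divr_gt0.
  have e'1 : e' < 1 by rewrite gt_min; apply/orP; left; lra.
  have e'L : e' * (L + 1) <= e by rewrite -ler_pdivlMr// ge_min lexx orbT.
  have := key _ e'0 e'1; lra.
move=> e0 e1; pose f x := d x - (1 - e) * enorm (x - x0).
have cf : continuous f.
  apply: (@lipschitz_continuous _ _ _ 2) => x y.
  have h1 := bdist_triangle x y.
  have h2 := bdist_triangle y x.
  have h3 := enorm_triangle y x x0; have h4 := enorm_triangle x y x0.
  rewrite (enorm_distC y x) in h2 h4.
  have e1' : 0 <= 1 - e by lra.
  have := ler_wpM2l e1' h3; have := ler_wpM2l e1' h4.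
  have := mulr_ge0 (ltW e0) (enorm_ge0 (x - y)).
  rewrite /f ler_norml => *; apply/andP; split; lra.
have K0 : K !=set0 by exists x0; exact: Omega_closure.
have [|x /set_mem Kx hx] := compact_EVT_max (f := f) K0 compact_closure.
  exact: continuous_subspaceT.
have fx y : K y -> f y <= f x by move=> Ky; apply/hx/mem_set.
have dx : d x0 + (1 - e) * enorm (x - x0) <= d x.
  by have := fx _ (Omega_closure Ox0); rewrite /f subrr enorm0; lra.
have dx0 := bdist_gt0 Ox0.
have ex : 0 <= (1 - e) * enorm (x - x0) by rewrite mulr_ge0 ?enorm_ge0//; lra.
have dx_gt0 : 0 < d x by lra.
have Ox : Omega x by apply: (bdist_gt0_Omega).
have [Mx|Mx] := pselect (M x).
  have [_ /(_ _ Mx)] := ridge_projP x0; rewrite (enorm_distC x0 x) => h.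
  have : (1 - e) * L <= (1 - e) * enorm (x - x0).
    by rewrite ler_wpM2l//; lra.
  by case: Mx => _ <-; lra.
have [p fp ep] := bdist_attained x.
have g1 := bdist_gradient (dd _ Ox Mx) fp ep.
have [r r0 hr] := open_segment (x - p) Omega_open Ox.
have : dot (gradient d x) (x - p) <= (1 - e) * d x.
  apply: (@gradient_le _ _ _ _ _ _ 0 r) => // [|t t0 tr]; first exact: dd.
  have := fx _ (Omega_closure (hr t _)); rewrite gtr0_norm// => /(_ tr).
  have e1' : 0 <= 1 - e by lra.
  have := enorm_triangle x (x + t *: (x - p)) x0.
  rewrite [x + _ - x]addrC addKr enormZ gtr0_norm// ep => /(ler_wpM2l e1').
  rewrite /f mul0r addr0; lra.
have -> : dot (gradient d x) (x - p) = - dot (gradient d x) (p - x).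
  by rewrite -dotNr opprB.
have := mulr_gt0 e0 dx_gt0; lra.
Qed.

Lemma ridge_lower_distance x : rho - d x <= enorm (x - pr x).
Proof.
have [[_ dP] _] := ridge_projP x.
have := bdist_triangle (pr x) x.
rewrite dP enorm_distC; lra.
Qed.

(** The test direction leads away from the ridge. Off the ridge, moving away
    from the projection keeps the distance to the ridge growing at speed one; on
    the ridge the same happens on the way to a nearest frontier point. *)
Lemma paraboloid_supersolution : viscosity_supersolution Omega (paraboloid M rho).
Proof.
have cM := ridge_compact.
have M0 := ridge_neq0.
have sM := ridge_segment.
split; first by apply: continuous_lsc_on; exact: paraboloid_continuous.
move=> x phi Ox Cphi touch.
have gE := touching_gradient_below M0 cM sM Omega_open Ox Cphi touch.
suff [v [v0 vg hv]] : exists v, [/\ v != 0,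
    (pr x - x != 0 -> pr x - x = - v) & forall t, 0 < t -> t < 1 ->
    paraboloid M rho (x + t *: v) <=
    paraboloid M rho x + dot (pr x - x) v * t - dot v v / 2 * t ^+ 2].
  have H : dot (v *m hessian phi x) v <= - dot v v.
    have [r r0 hr] := open_segment v Omega_open Ox.
    have m0 : 0 < Num.min r 1 by rewrite lt_min r0 ltr01.
    apply: (@hessian_le _ _ _ _ _ _ _ (Num.min r 1) Omega_open Ox Cphi m0) => t t0.
    rewrite lt_min => /andP[tr t1].
    have [e h] := touch; have := h _ (hr t _); rewrite (gtr0_norm t0) => /(_ tr) /le_trans; apply.
    by rewrite e gE (le_trans (hv _ t0 t1))// mulNr mulNr.
  rewrite lerNr /inf_laplacian_inf gE; case: ifPn => [/vg e|_].
    rewrite /inf_laplacian gE e enormN enorm_sqr ler_pdivrMl ?dot_gt0//.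
    by rewrite mulNmx dotNl dotNr opprK mulrN1.
  apply: (@lambda_min_le _ _ _ _ v) => //; last by rewrite mulN1r.
  by move=> y z; exact: hessian_sym Omega_open Ox Cphi.
have [Px|Px] := eqVneq (pr x - x) 0.
  have [p fp ep] := bdist_attained x.
  have xP : pr x = x by apply/subr0_eq.
  have dx : d x = rho by have [[_ <-] _] := ridge_projP x; rewrite xP.
  have rho0 := inradius_gt0.
  have ev : enorm (p - x) = rho by rewrite enorm_distC ep.
  exists (p - x); split=> //; first by rewrite -enorm_gt0 ev.
  move=> t t0 t1; rewrite Px dot0l mul0r addr0 -enorm_sqr ev /paraboloid xP subrr dot0l.
  set y := x + _; have := ridge_lower_distance y.
  have := bdist_toward fp ep (ltW t0) (ltW t1); rewrite -/y dx => h1 h2.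
  have h3 : t * rho <= enorm (y - pr y) by lra.
  have : (t * rho) ^+ 2 <= enorm (y - pr y) ^+ 2.
    by rewrite ler_pXn2r// nnegrE ?enorm_ge0// mulr_ge0 ?ltW.
  rewrite enorm_sqr exprMn; lra.
exists (x - pr x); split.
- by rewrite -oppr_eq0 opprB.
- by rewrite opprB.
move=> t t0 t1; rewrite /paraboloid; set y := x + _.
have [My _] := ridge_projP y.
have := proj_obtuse M0 cM sM x My.
have -> : y - pr y = (1 + t) *: (x - pr x) - (pr y - pr x).
  by rewrite /y; apply/rowP => i; rewrite !mxE; ring.
rewrite -(opprB x (pr x)); move: (x - pr x) (pr y - pr x) => v w h.
have := dot_ge0 w; rewrite !dotE (dotC w v).
have := mulr_ge0 (ltW t0) (_ : 0 <= - dot v w); rewrite oppr_ge0 => /(_ h).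
move: h; move: (dot v w) (dot v v) (dot w w) => a b c h1 h2 h3; nra.
Qed.

(** On the frontier the distance to the ridge is [rho] by approximation from
    inside, so the gradient [proj x - x] has constant length there. *)
Lemma stadium_overdetermined : cut_locus Omega = M ->
  overdetermined_solution Omega rho (paraboloid M rho).
Proof.
move=> cutM.
have cM := ridge_compact.
have M0 := ridge_neq0.
have sM := ridge_segment.
have dd x : Omega x -> ~ M x -> differentiable d x.
  move=> Ox Mx; apply: contrapT => nd; apply: Mx; rewrite -cutM.
  by apply: subset_closure; split.
have cpar := @paraboloid_continuous _ _ _ M0 cM sM rho.
have fdist p : frontier Omega p -> enorm (p - pr p) = rho.
  move=> fp; apply/eqP; rewrite eq_le; apply/andP; split; last first.
    have := ridge_lower_distance p.
    by rewrite (bdist_frontier fp) subr0.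
  apply/ler_addgt0Pr => e e0.
  have /closure_enormP/(_ _ e0)[x Ox xp] := frontier_closure fp.
  have [Mx _] := ridge_projP x; have [_ /(_ _ Mx)] := ridge_projP p.
  have := enorm_triangle x p (pr x); have := ridge_at_distance dd Ox.
  have := bdist_ge0 x.
  rewrite (enorm_distC p x); move: xp.
  by move: (enorm _) (enorm _) (enorm _) (enorm _) => *; lra.
split.
- split; first exact: continuous_subspaceT.
  + exact: paraboloid_subsolution.
  + exact: paraboloid_supersolution.
- move=> p fp; rewrite /paraboloid -enorm_sqr fdist//; lra.
exists (fun x => pr x - x); last by move=> p fp; rewrite enorm_distC fdist.
split.
- exact: continuous_subspaceT.
- by move=> x _; have [] := paraboloid_gradient M0 cM sM rho x.
- apply: continuous_subspaceT; apply: lipschitz_continuous_rV => x y.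
  exact: proj_sub_lipschitz.
- by move=> x _; have [_ ->] := paraboloid_gradient M0 cM sM rho x.
Qed.

(** * Comparison and descent for solutions *)

Section Solution.
Variables (c : R) (u : 'rV[R]_n -> R) (g : 'rV[R]_n -> 'rV[R]_n).
Hypotheses (u_sub : viscosity_subsolution Omega u)
  (u_sup : viscosity_supersolution Omega u)
  (u_frontier : forall x, frontier Omega x -> u x = 0)
  (u_cont : {within K, continuous u})
  (u_diff : forall x, Omega x -> differentiable u x)
  (g_cont : {within K, continuous g})
  (g_grad : forall x, Omega x -> g x = gradient u x)
  (g_frontier : forall x, frontier Omega x -> enorm (g x) = c).

Let K_neq0 : K !=set0.
Proof. by have [x Ox] := Omega_neq0; exists x; exact: Omega_closure. Qed.

Lemma solution_ge0 x : K x -> 0 <= u x.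
Proof.
have [x1 /set_mem Kx1 hx1] := compact_EVT_min K_neq0 compact_closure u_cont.
move=> Kx; apply: le_trans (hx1 x (mem_set Kx)).
rewrite leNgt; apply/negP => ux1.
have [Ox1|/u_frontier e] := closure_split Kx1; last by rewrite e ltxx in ux1.
suff : (1 : R) <= 1 / 2 by lra.
apply: (@supersolution_radial _ _ n_gt0 Omega u x1 x1 0 (1 / 2) 1 (u x1)) => //.
- by move=> y Oy; apply/hx1/mem_set/Omega_closure.
- by left.
- move=> y Oy _; apply: le_trans (hx1 y (mem_set (Omega_closure Oy))).
  rewrite subrr enorm0 !mul0r expr0n mulr0 !add0r addr0 gerBl mulr_ge0 ?sqr_ge0//.
Qed.

Lemma solution_le : exists B, forall x, K x -> u x <= B.
Proof.
have [x1 /set_mem Kx1 hx1] := compact_EVT_max K_neq0 compact_closure u_cont.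
by exists (u x1) => x Kx; apply/hx1/mem_set.
Qed.

Lemma eball_closure x r : Omega x -> r < d x -> [set y | enorm (y - x) <= r] `<=` Omega.
Proof. by move=> Ox rd y /= yr; apply: (bdist_ball Ox); exact: le_lt_trans rd. Qed.

Lemma radial_continuous x0 (b k : R) :
  continuous (fun y => b * enorm (y - x0) + k / 2 * enorm (y - x0) ^+ 2).
Proof.
have cE := @edist_continuous R n x0; move=> y.
exact: (continuousD (continuousM (@cst_continuous _ _ b y) (cE y))
  (continuousM (@cst_continuous _ _ (k / 2) y) (continuousM (cE y) (cE y)))).
Qed.

(** At an interior minimum of [u] minus the profile, the supersolution property
    would give [k >= 1]. For [b > 0] the profile has a concave kink at the centre,
    where this test says nothing; the condition [a <= u x0] keeps negative
    minima away from it. *)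
Lemma compare_below x0 r (a b k : R) : Omega x0 -> r < d x0 -> 0 <= r ->
  0 <= b -> 0 < k -> k < 1 -> b = 0 \/ a <= u x0 ->
  (forall y, enorm (y - x0) = r -> a - (b * r + k / 2 * r ^+ 2) <= u y) ->
  forall y, enorm (y - x0) <= r ->
    a - (b * enorm (y - x0) + k / 2 * enorm (y - x0) ^+ 2) <= u y.
Proof.
move=> Ox0 rd r0 b0 k0 k1 ab hr y yr.
have sB := eball_closure Ox0 rd.
pose q y := b * enorm (y - x0) + k / 2 * enorm (y - x0) ^+ 2.
pose B := [set y | enorm (y - x0) <= r].
have B0 : B !=set0 by exists x0; rewrite /B /= subrr enorm0.
have cf : {within B, continuous (fun y => u y + q y)}.
  apply: within_continuousD.
    by apply: continuous_subspaceW u_cont => z /sB; exact: Omega_closure.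
  by apply: continuous_subspaceT; exact: radial_continuous.
have [x /set_mem Bx hx] := compact_EVT_min B0 (@eball_compact x0 r) cf.
suff : a <= u x + q x by have := hx y (mem_set yr); rewrite -/(q y); lra.
rewrite leNgt; apply/negP => ax.
have xr : enorm (x - x0) < r.
  rewrite lt_neqAle Bx andbT; apply/negP => /eqP e.
  by have := hr _ e; move: ax; rewrite /q e; lra.
have Ox := sB _ Bx.
have xx0 : b = 0 \/ x != x0.
  have [->|] := eqVneq b 0; [by left|move=> bN0; right; apply/eqP => e].
  case: ab => [b00|au]; first by rewrite b00 eqxx in bN0.
  by move: ax; rewrite /q e subrr enorm0 expr0n !mulr0 !addr0; lra.
suff : 1 <= k by lra.
have s0 : 0 < r - enorm (x - x0) by lra.
apply: (@supersolution_radial _ _ n_gt0 Omega u x0 x b k (r - enorm (x - x0)) 0) => //.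
  by move=> z Oz; apply: solution_ge0; exact: Omega_closure.
move=> z Oz zx; have Bz : B z.
  rewrite /B /=; have := enorm_triangle x z x0; lra.
by have := hx z (mem_set Bz); rewrite /q; lra.
Qed.

(** Compare on balls of radius [r < d z] with [k/2 (r^2 - |y - z|^2)], [k < 1],
    and let [r] and [k] tend to [d z] and [1]. *)
Lemma paraboloid_below z y : Omega z -> enorm (y - z) < d z ->
  (d z ^+ 2 - enorm (y - z) ^+ 2) / 2 <= u y.
Proof.
move=> Oz yz; have s0 := enorm_ge0 (y - z); set s := enorm (y - z) in yz s0 *.
set D := d z in yz *.
apply: (@le_of_slack _ _ _ ((D ^+ 2 - s ^+ 2) / 2 + D * (D - s))) => t t0 t1.
pose r := D - t * (D - s).
have rD : r < D by rewrite /r gtrBl mulr_gt0// subr_gt0.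
have sr : s <= r.
  rewrite /r -subr_ge0 (_ : _ - s = (1 - t) * (D - s)); last by ring.
  by rewrite mulr_ge0// subr_ge0 ltW.
have r0 : 0 <= r by exact: le_trans sr.
have k0 : 0 < 1 - t by lra.
have k1 : 1 - t < 1 by lra.
have hr y' : enorm (y' - z) = r ->
    (1 - t) / 2 * r ^+ 2 - (0 * r + (1 - t) / 2 * r ^+ 2) <= u y'.
  rewrite mul0r add0r subrr => hy'; apply/solution_ge0/Omega_closure.
  by apply: (eball_closure Oz rD); rewrite /= hy'.
have := compare_below Oz rD r0 (lexx 0) k0 k1 (or_introl erefl) hr sr.
rewrite -/s mul0r add0r => h.
have hD : D ^+ 2 - 2 * t * (D * (D - s)) <= r ^+ 2.
  rewrite -subr_ge0 (_ : _ - _ = (t * (D - s)) ^+ 2) ?sqr_ge0//.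
  by rewrite /r; ring.
have t1' : 0 <= 1 - t by lra.
have := ler_wpM2l t1' hD.
have : 0 <= t * (t * (D * (D - s))).
  have D0 : 0 <= D by lra.
  have Ds : 0 <= D - s by lra.
  by rewrite !mulr_ge0// ltW.
move: h; lra.
Qed.

Lemma solution_gt0 x : Omega x -> 0 < u x.
Proof.
move=> Ox; have dx := bdist_gt0 Ox.
have := @paraboloid_below x x Ox; rewrite subrr enorm0 => /(_ dx).
by apply: lt_le_trans; rewrite expr0n subr0 divr_gt0// exprn_gt0.
Qed.

Lemma esphere_neq0 (x : 'rV[R]_n) r : 0 <= r -> [set y | enorm (y - x) = r] !=set0.
Proof.
move=> r0; exists (x + r *: delta_mx 0 (Ordinal n_gt0)) => /=.
by rewrite addrC addKr enormZ /enorm dot_delta mxE !eqxx sqrtr1 mulr1 ger0_norm.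
Qed.

(** One step of the downward gradient flow. Comparison with the profile through
    the centre and the minimum [y1] on a sphere makes [|Du|^2/2 + u] grow from
    the centre to [y1], while [u] strictly decreases. *)
Lemma descent_step x0 : Omega x0 -> exists y1, [/\ Omega y1, u y1 < u x0 &
  dot (gradient u x0) (gradient u x0) / 2 + u x0 <=
  dot (gradient u y1) (gradient u y1) / 2 + u y1].
Proof.
move=> Ox0; pose r := d x0 / 2; have dx0 := bdist_gt0 Ox0.
have r_gt0 : 0 < r by rewrite divr_gt0.
have rd : r < d x0 by rewrite /r; lra.
have r0 := ltW r_gt0.
have sB := eball_closure Ox0 rd.
pose S := [set y | enorm (y - x0) = r].
have [|y1 /set_mem Sy1 hy1] := compact_EVT_min (f := u) (esphere_neq0 x0 r0) (@compact_esphere _ _ x0 r).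
  by apply: continuous_subspaceW u_cont => z /= zr; apply/Omega_closure/sB; rewrite /= zr.
have Oy1 : Omega y1 by apply: sB; rewrite /= Sy1.
set a := u y1 in hy1 *.
have hS y : enorm (y - x0) = r -> a <= u y by move=> yr; apply/hy1/mem_set.
(* the slope for which the profile takes the value [a] at radius [r] *)
pose b := (u x0 - a) / r - r / 2.
have aE : a = u x0 - (b * r + r ^+ 2 / 2).
  by rewrite /b; field; rewrite lt0r_neq0.
have b0 : 0 <= b.
  suff : a + r ^+ 2 / 2 <= u x0.
    rewrite -(pmulr_lge0 _ r_gt0) aE; lra.
  apply: (@le_of_slack _ _ _ (r ^+ 2 / 2)) => t t0 t1.
  have k0 : 0 < 1 - t by lra.
  have k1 : 1 - t < 1 by lra.
  have hb y : enorm (y - x0) = r ->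
      a + (1 - t) / 2 * r ^+ 2 - (0 * r + (1 - t) / 2 * r ^+ 2) <= u y.
    by move=> yr; rewrite mul0r add0r addrK hS.
  have hc : enorm (x0 - x0) <= r by rewrite subrr enorm0.
  have := compare_below Ox0 rd r0 (lexx 0) k0 k1 (or_introl erefl) hb hc.
  rewrite subrr enorm0 expr0n mul0r mulr0 addr0; lra.
have ball y : enorm (y - x0) <= r ->
    u x0 - (b * enorm (y - x0) + enorm (y - x0) ^+ 2 / 2) <= u y.
  move=> yr; set s := enorm (y - x0) in yr *.
  apply: (@le_of_slack _ _ _ (r * s / 2 - s ^+ 2 / 2)) => t t0 t1.
  have k0 : 0 < 1 - t by lra.
  have k1 : 1 - t < 1 by lra.
  have bk : 0 <= b + t * r / 2 by rewrite addr_ge0// divr_ge0// mulr_ge0// ltW.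
  have hb y' : enorm (y' - x0) = r ->
      u x0 - ((b + t * r / 2) * r + (1 - t) / 2 * r ^+ 2) <= u y'.
    by move=> /hS; apply: le_trans; rewrite aE; lra.
  have := compare_below Ox0 rd r0 bk k0 k1 (or_intror (lexx _)) hb yr.
  rewrite -/s; lra.
have lower : enorm (gradient u x0) <= b.
  set v := gradient u x0; have [->|v0] := eqVneq v 0; first by rewrite enorm0.
  have L0 : 0 < enorm v by rewrite enorm_gt0.
  rewrite -(ler_pM2r L0) -expr2 enorm_sqr -lerN2 -dotNr -/v.
  apply: (@gradient_ge _ _ u x0 (- v) _ (- (enorm v ^+ 2 / 2)) (r / enorm v)).
  - exact: u_diff.
  - by rewrite divr_gt0.
  move=> t t0; rewrite ltr_pdivlMr// => tr.
  have := ball (x0 + t *: - v); rewrite addrC addKr enormZ enormN gtr0_norm// => /(_ (ltW tr)).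
  rewrite addrC exprMn; lra.
have upper : b + r <= enorm (gradient u y1).
  have rv : enorm (x0 - y1) = r by rewrite enorm_distC.
  rewrite -(ler_pM2r r_gt0); apply: (@le_trans _ _ (dot (gradient u y1) (x0 - y1))).
    apply: (@gradient_ge _ _ u y1 _ _ (- (r ^+ 2 / 2)) 1) => //; first exact: u_diff.
    move=> t t0 t1; set y := y1 + _.
    have yr : enorm (y - x0) = (1 - t) * r.
      rewrite (_ : y - x0 = (1 - t) *: (y1 - x0)); last first.
        by apply/rowP => i; rewrite !mxE; ring.
      by rewrite enormZ ger0_norm ?Sy1//; lra.
    have := ball y; rewrite yr -/a aE => h.
    suff : u x0 - (b * ((1 - t) * r) + ((1 - t) * r) ^+ 2 / 2) <= u y by lra.
    by apply: h; rewrite ler_piMl//; lra.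
  by rewrite -[X in _ <= _ * X]rv cauchy_schwarz.
exists y1; split=> //.
  rewrite -/a aE; have := mulr_ge0 b0 r0; have := exprn_gt0 2 r_gt0; lra.
rewrite -!enorm_sqr -/a aE.
have := ler_pXn2r (ltn0Sn 1) (enorm_ge0 (gradient u x0)) b0; rewrite lower => l2.
have br : 0 <= b + r by lra.
have := ler_pXn2r (ltn0Sn 1) br (enorm_ge0 (gradient u y1)); rewrite upper => u2.
have {}l2 : enorm (gradient u x0) ^+ 2 <= b ^+ 2 by rewrite l2.
have {}u2 : (b + r) ^+ 2 <= enorm (gradient u y1) ^+ 2 by rewrite u2.
lra.
Qed.

Lemma c_ge0 : 0 <= c.
Proof. by have [p /g_frontier <-] := frontier_neq0; exact: enorm_ge0. Qed.

(** Since a descent step increases [|Du|^2/2 + u - e u] strictly, this function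
    attains its maximum on the frontier, where it equals [c^2/2]. *)
Lemma P_function_le x : K x -> dot (g x) (g x) / 2 + u x <= c ^+ 2 / 2.
Proof.
move=> Kx; apply: (@le_of_slack _ _ _ (u x)) => t t0 t1.
pose f y := dot (g y) (g y) / 2 + (1 - t) * u y.
have cf : {within K, continuous f}.
  have c1 : continuous (fun v : 'rV[R]_n => dot v v / 2).
    move=> v; apply: (@continuousM _ _ (fun w : 'rV[R]_n => dot w w) (fun=> 2^-1)).
      exact: continuous_dot2.
    exact: cst_continuous.
  have c2 : continuous (fun s : R => (1 - t) * s).
    move=> s; apply: (@continuousM _ _ (fun=> 1 - t) id); first exact: cst_continuous.
    exact: cvg_id.
  apply: within_continuousD.
    by apply: (@within_continuous_comp _ _ _ K g (fun v => dot v v / 2)) => // v _; exact: c1.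
  by apply: (@within_continuous_comp _ _ _ K u (fun s => (1 - t) * s)) => // s _; exact: c2.
have [y /set_mem Ky hy] := compact_EVT_max K_neq0 compact_closure cf.
suff : f y <= c ^+ 2 / 2 by have := hy x (mem_set Kx); rewrite /f; lra.
have [Oy|fy] := closure_split Ky; last first.
  by rewrite /f -enorm_sqr g_frontier// u_frontier// mulr0 addr0.
have [y1 [Oy1 uy1 hP]] := descent_step Oy.
have := hy y1 (mem_set (Omega_closure Oy1)); rewrite /f !g_grad//.
have := mulr_gt0 t0 (_ : 0 < u y - u y1); rewrite subr_gt0 => /(_ uy1); lra.
Qed.

(** * The distance bound and ascent for solutions *)

Lemma half_sq_bound x : K x -> 0 <= c ^+ 2 - 2 * u x.
Proof. by move=> Kx; have := P_function_le Kx; have := dot_ge0 (g x); lra. Qed.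

Lemma c_gt0 : 0 < c.
Proof.
have [x Ox] := Omega_neq0; rewrite lt0r c_ge0 andbT; apply/eqP => c0.
have := half_sq_bound (Omega_closure Ox); have := solution_gt0 Ox.
by rewrite c0 expr0n /=; lra.
Qed.

(** [sqrt (c^2 - 2 u)] has slope at most one because [|Du|^2 <= c^2 - 2 u], and
    it equals [c] on the frontier; the perturbation by [e] keeps the square
    root differentiable. *)
Lemma frontier_upper_bound x : Omega x -> d x < c -> (c - d x) ^+ 2 <= c ^+ 2 - 2 * u x.
Proof.
move=> Ox dc; apply/ler_addgt0Pr => e e0.
have [p fp ep] := bdist_attained x; set s := d x in dc ep *.
have s0 : 0 < s by exact: bdist_gt0.
have c0 := c_ge0.
have e20 : 0 < e / 2 by lra.
have [r r0 hr] := within_enormP u_cont (frontier_closure fp) e20.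
(* stop short of [p], where [u] need not be differentiable *)
have [tau [tau0 tau1 htau]] : exists tau, [/\ 0 < tau, tau < 1 & (1 - tau) * s < r].
  exists (1 - Num.min (1 / 2) (r / s / 2)).
  have rs : 0 < r / s by rewrite divr_gt0.
  have m0 : 0 < Num.min (1 / 2) (r / s / 2) by rewrite lt_min !divr_gt0.
  have m1 : Num.min (1 / 2) (r / s / 2) <= 1 / 2 by rewrite ge_min lexx.
  have m2 : Num.min (1 / 2) (r / s / 2) < r / s by rewrite gt_min; apply/orP; right; lra.
  split; [lra|lra|]; rewrite opprB addrC subrK -ltr_pdivlMr//.
pose y t := x + t *: (p - x).
have Oy t : 0 <= t -> t <= tau -> Omega (y t).
  move=> t0 tt; apply: (bdist_ball Ox); rewrite /y addrC addKr enormZ ger0_norm//.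
  by rewrite enorm_distC ep gtr_pMl//; lra.
pose F v := c ^+ 2 - 2 * u v + e.
have F0 t : 0 <= t -> t <= tau -> 0 < F (y t).
  by move=> t0 tt; rewrite ltr_wpDl//; apply/half_sq_bound/Omega_closure/Oy.
pose h t := Num.sqrt (F (y t)).
pose dh t := (2 * Num.sqrt (F (y t)))^-1 * (- (2 * dot (gradient u (y t)) (p - x))).
have hd t : 0 <= t -> t <= tau -> is_derive t 1 h (dh t).
  move=> t0 tt; rewrite /h /dh.
  have d1 := is_derive_line_gradient (u_diff (Oy t t0 tt)).
  have d2 : is_derive t 1 (fun t => F (y t)) (- (2 * dot (gradient u (y t)) (p - x))).
    have := is_deriveD (is_deriveB (is_derive_cst (c ^+ 2) t (1 : R)) (is_deriveZ 2 d1))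
      (is_derive_cst e t (1 : R)).
    by rewrite sub0r addr0.
  have d3 := is_derive1_sqrt (F0 t t0 tt).
  exact: (@is_derive1_comp R (@Num.sqrt R) (fun t => F (y t)) t _ _ d3 d2).
have slope t : 0 <= t -> t <= tau -> dh t <= s.
  move=> t0 tt; have w0 := F0 t t0 tt.
  set w := Num.sqrt (F (y t)); have w_gt0 : 0 < w by rewrite sqrtr_gt0.
  have gw : enorm (gradient u (y t)) <= w.
    rewrite enorm_leP ?ltW// sqr_sqrtr ?ltW// /F.
    have := P_function_le (Omega_closure (Oy t t0 tt)); rewrite g_grad//; last exact: Oy.
    lra.
  rewrite /dh -/w ler_pdivrMl ?mulr_gt0// -mulrN -mulrA ler_pM2l// -dotNr opprB.
  apply: le_trans (cauchy_schwarz _ _) _.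
  by rewrite ep ler_wpM2r// ltW.
have ch : {within `[0, tau], continuous h}.
  apply: derivable_within_continuous => t; rewrite in_itv/= => /andP[t0 tt].
  by apply: ex_derive; exact: hd.
have [|t] := MVT (df := dh) tau0 _ ch.
  by move=> t; rewrite in_itv/= => /andP[t0 tt]; apply: hd; exact: ltW.
rewrite in_itv/= subr0 => /andP[t0 tt] hE.
have h1 : h tau - h 0 <= s.
  rewrite hE; apply: (@le_trans _ _ (s * tau)).
    by rewrite ler_pM2r// slope// ltW.
  by rewrite ler_piMr// ltW.
have h2 : c <= h tau.
  rewrite /h -[leLHS]ger0_norm// -sqrtr_sqr ler_wsqrtr// /F.
  have := hr (y tau) (Omega_closure (Oy _ (ltW tau0) (lexx _))).
  rewrite (_ : y tau - p = (1 - tau) *: (x - p)); last first.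
    by apply/rowP => i; rewrite !mxE; ring.
  rewrite enormZ ep ger0_norm ?subr_ge0 ?(ltW tau1)// => /(_ htau).
  rewrite (u_frontier fp) subr0 => /ltW /(le_trans (ler_norm _)); lra.
have h3 : c - s <= h 0 by lra.
have cs0 : 0 <= c - s by lra.
have : (c - s) ^+ 2 <= h 0 ^+ 2 by rewrite ler_pXn2r// nnegrE sqrtr_ge0.
by rewrite /h sqr_sqrtr ?(ltW (F0 0 (lexx _) (ltW tau0)))// /F /y scale0r addr0.
Qed.

(** Otherwise [u] would lie below a profile [u x0 + b s - k s^2/2] with [k > 1],
    whose slope [b] at [x0] is smaller than [|Du x0|]. The constants are chosen
    with [k r < b], so that the profile has no critical point on the ball. *)
Lemma ascent_step x0 r : Omega x0 -> 0 < r -> r < enorm (gradient u x0) ->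
  exists z, [/\ K z, enorm (z - x0) <= r &
    u x0 + (enorm (gradient u x0) * r - r ^+ 2 / 2) <= u z].
Proof.
move=> Ox0 r0; set L := enorm _ => rL.
pose B := K `&` [set y | enorm (y - x0) <= r].
have cB : compact B.
  apply: compact_closedI; first exact: compact_closure.
  by apply: compact_closed; [exact: norm_hausdorff|exact: eball_compact].
have B0 : B !=set0.
  by exists x0; split; [exact: Omega_closure|rewrite /= subrr enorm0 ltW].
have uB : {within B, continuous u} by apply: continuous_subspaceW u_cont => y [].
have [z /set_mem[Kz zr] hz] := compact_EVT_max B0 cB uB.
exists z; split=> //; rewrite leNgt; apply/negP => uz.
pose e := u x0 + (L * r - r ^+ 2 / 2) - u z.
have e0 : 0 < e by rewrite /e; lra.
pose tau := Num.min ((L - r) / (1 + r) / 2) (e / (r + r ^+ 2 / 2)).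
have r1 : 0 < 1 + r by lra.
have r2 : 0 < r + r ^+ 2 / 2 by rewrite addr_gt0// divr_gt0// exprn_gt0.
have Lr : 0 < (L - r) / (1 + r) by rewrite divr_gt0// subr_gt0.
have tau0 : 0 < tau by rewrite lt_min !divr_gt0// subr_gt0.
have tau1 : tau * (1 + r) < L - r.
  by rewrite -ltr_pdivlMr// gt_min; apply/orP; left; lra.
have tau2 : tau * (r + r ^+ 2 / 2) <= e by rewrite -ler_pdivlMr// ge_min lexx orbT.
pose b := L - tau; pose k := 1 + tau.
have bk : k * r < b by rewrite /b /k; lra.
have k0 : 0 < k by rewrite /k; lra.
have b0 : 0 < b by apply: lt_trans bk; rewrite mulr_gt0.
pose q y := - b * enorm (y - x0) + k / 2 * enorm (y - x0) ^+ 2.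
have cf : {within B, continuous (fun y => u y + q y)}.
  by apply: within_continuousD => //; apply: continuous_subspaceT; exact: radial_continuous.
have [x /set_mem[Kx xr] hx] := compact_EVT_max B0 cB cf; rewrite /= in xr.
have q_le0 y : enorm (y - x0) <= r -> q y <= 0.
  move=> yr; have s0 := enorm_ge0 (y - x0); rewrite /q.
  have : k * enorm (y - x0) <= b by apply: le_trans (ltW bk); rewrite ler_pM2l.
  have -> : - b * enorm (y - x0) + k / 2 * enorm (y - x0) ^+ 2 =
     - ((b - k * enorm (y - x0)) * enorm (y - x0) + k / 2 * enorm (y - x0) ^+ 2).
    by field.
  move=> h; rewrite oppr_le0 addr_ge0// mulr_ge0// ?subr_ge0//; first by rewrite divr_ge0// ltW.
  by rewrite exprn_ge0.
have fx : u x + q x <= u x0.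
  rewrite leNgt; apply/negP => ux.
  have xx0 : x != x0.
    apply/eqP => ex; move: ux; rewrite ex /q subrr enorm0 expr0n !mulr0 !addr0; lra.
  have xr' : enorm (x - x0) < r.
    rewrite lt_neqAle xr andbT; apply/negP => /eqP exr; move: ux; rewrite /q exr.
    have := hz x (mem_set (conj Kx xr)); move: tau2; rewrite /e /b /k; lra.
  have Ox : Omega x.
    case: (closure_split Kx) => // /u_frontier ux0.
    by have := q_le0 x xr; have := solution_gt0 Ox0; move: ux; rewrite ux0; lra.
  have [D hD] := Omega_enorm_bounded; have [Bu hBu] := solution_le.
  suff : k <= 1 by rewrite /k; lra.
  apply: (@subsolution_radial _ _ Omega u x0 x b k (r - enorm (x - x0)) Bu (D + D)) => //.
  - by move=> y /Omega_closure/hBu.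
  - move=> y Oy; have := enormD y (- x0); rewrite enormN.
    have := hD y (Omega_closure Oy); have := hD x0 (Omega_closure Ox0); lra.
  - exact: ltW.
  - exact: ltW.
  - apply/eqP => eb; have : k * enorm (x - x0) < k * r by rewrite ltr_pM2l.
    by rewrite -eb; lra.
  - by rewrite subr_gt0.
  move=> y Oy yx; have By : B y.
    split; [exact: Omega_closure|rewrite /=; have := enorm_triangle x y x0; lra].
  have := hx y (mem_set By); rewrite /q; lra.
have L0 : 0 < L by lra.
suff : L <= b by rewrite /b; lra.
rewrite -(ler_pM2r L0) -expr2 enorm_sqr.
have [r3 r30 hr3] := open_segment (gradient u x0) Omega_open Ox0.
have m0 : 0 < Num.min r3 (r / L) by rewrite lt_min r30 divr_gt0.
apply: (@gradient_le _ _ u x0 _ _ 0 (Num.min r3 (r / L))) => //; first exact: u_diff.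
move=> t t0; rewrite lt_min ltr_pdivlMr// => /andP[tr3 tr].
have Oy := hr3 t; rewrite gtr0_norm// in Oy; have {}Oy := Oy tr3.
have Ey : enorm (x0 + t *: gradient u x0 - x0) = t * L.
  by rewrite addrC addKr enormZ gtr0_norm.
have By : B (x0 + t *: gradient u x0).
  by split; [exact: Omega_closure|rewrite /= Ey ltW].
have := hx _ (mem_set By); rewrite {1}/q Ey.
have : 0 <= k / 2 * (t * L) ^+ 2.
  by rewrite mulr_ge0 ?sqr_ge0// divr_ge0// ltW.
lra.
Qed.

(** Ascent steps of length almost [c] start from interior points tending to [p];
    the function [f] is positive exactly when one of the two wanted
    inequalities fails, and its minimum is attained. *)
Lemma touching_point p : frontier Omega p ->
  exists z, [/\ K z, enorm (z - p) <= c & c ^+ 2 / 2 <= u z].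
Proof.
move=> fp; pose f z := Num.max (enorm (z - p) - c) (c ^+ 2 / 2 - u z).
have cf : {within K, continuous f}.
  have c1 : {within K, continuous (fun z => enorm (z - p) - c)}.
    apply: within_continuousB; apply: continuous_subspaceT; first exact: edist_continuous.
    by move=> y; exact: cst_continuous.
  have c2 : {within K, continuous (fun z => c ^+ 2 / 2 - u z)}.
    by apply: within_continuousB => //; apply: continuous_subspaceT => y; exact: cst_continuous.
  by move=> z; exact: (@continuous_max R _ _ _ z (c1 z) (c2 z)).
have [z /set_mem Kz hz] := compact_EVT_min K_neq0 compact_closure cf.
suff : f z <= 0 by rewrite /f ge_max !subr_le0 => /andP[h1 h2]; exists z; split.
apply: (@le_of_slack _ _ _ (c ^+ 2 / 2)) => t t0 t1; rewrite add0r.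
have c_pos := c_gt0; pose e := t * c / 2; have e0 : 0 < e by rewrite divr_gt0// mulr_gt0.
have ec : 2 * e < c by rewrite /e mulrC divfK// gtr_pMl.
have cg : {within K, continuous (fun y => enorm (g y))}.
  by apply: (@within_continuous_comp _ _ _ K g (@enorm R n)) => // v _; exact: enorm_continuous.
have [r r0 hr] := within_enormP cg (frontier_closure fp) e0.
have m0 : 0 < Num.min r e by rewrite lt_min r0.
have /closure_enormP/(_ _ m0)[x Ox] := frontier_closure fp.
rewrite lt_min => /andP[xr xe].
have := hr x (Omega_closure Ox) xr; rewrite (g_frontier fp) ltr_norml => /andP[gl _].
have := P_function_le (Omega_closure Ox); rewrite -enorm_sqr.
have ux := solution_gt0 Ox; rewrite g_grad// in gl *.
set L := enorm (gradient u x) in gl * => PL.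
have Lc : L <= c.
  by rewrite -(ler_pXn2r (ltn0Sn 1)) ?nnegrE ?enorm_ge0 ?(ltW c_pos)//; lra.
have Le0 : 0 < L - e by lra.
have LeL : L - e < L by lra.
have [z' [Kz' zx uz]] := ascent_step Ox Le0 LeL.
apply: (le_trans (hz z' (mem_set Kz'))); rewrite /f ge_max; apply/andP; split.
  have := enorm_triangle x z' p.
  have : 0 <= t * (c ^+ 2 / 2) by rewrite mulr_ge0 ?(ltW t0)// divr_ge0// sqr_ge0.
  lra.
have hL : (c - e) ^+ 2 <= L ^+ 2 by rewrite ler_pXn2r ?nnegrE ?enorm_ge0//; lra.
have : e * c = t * (c ^+ 2 / 2) by rewrite /e; field.
move: uz hL; rewrite -/L; lra.
Qed.

(** * Rigidity of solutions *)

Lemma bdist_ge_c z : K z -> c ^+ 2 / 2 <= u z -> Omega z /\ c <= d z.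
Proof.
move=> Kz uz; have c0 := c_gt0; have c20 : 0 < c ^+ 2 by rewrite exprn_gt0.
have Oz : Omega z.
  by case: (closure_split Kz) => // /u_frontier uz0; move: uz; rewrite uz0; lra.
split=> //; rewrite leNgt; apply/negP => dc.
have := frontier_upper_bound Oz dc.
have : 0 < (c - d z) ^+ 2 by rewrite exprn_gt0// subr_gt0.
lra.
Qed.

(** The upper bound on [u] forces [d >= c] where [u] reaches [c^2/2], and the
    paraboloid below [u] on an inscribed ball of radius [rho] has height
    [rho^2/2]. *)
Lemma c_inradius : c = rho.
Proof.
have [p fp] := frontier_neq0; have [z [Kz _ uz]] := touching_point fp.
have [Oz cz] := bdist_ge_c Kz uz.
apply/eqP; rewrite eq_le (le_trans cz (bdist_le_inradius Kz))/=.
have [m Mm] := ridge_neq0; have Om := ridge_Omega Mm.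
have := @paraboloid_below m m Om; rewrite subrr enorm0 => /(_ (bdist_gt0 Om)).
case: Mm => Km ->; have := half_sq_bound Km => h1 h2.
rewrite -(ler_pXn2r (ltn0Sn 1)) ?nnegrE ?c_ge0 ?(ltW inradius_gt0)//.
by move: h2; rewrite expr0n /=; lra.
Qed.

Lemma touching_ridge p : frontier Omega p -> exists2 m, M m & enorm (m - p) <= rho.
Proof.
move=> fp; have [z [Kz zp uz]] := touching_point fp.
have [Oz cz] := bdist_ge_c Kz uz.
rewrite c_inradius in cz zp; exists z => //; split=> //.
by apply/eqP; rewrite eq_le cz bdist_le_inradius.
Qed.

(** The ray from the projection [m] of [x] on the ridge through [x] leaves the
    domain at a point [p] whose projection on the ridge is again [m], so that
    [|p - m| <= rho]. *)
Lemma ridge_distance_le x : Omega x -> enorm (x - proj M x) <= rho - d x.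
Proof.
move=> Ox; have [Mm _] := ridge_projP x; set m := proj M x in Mm *.
have obt q : M q -> dot (x - m) (q - m) <= 0.
  exact: (proj_obtuse ridge_neq0 ridge_compact ridge_segment).
have [->|v0] := eqVneq (x - m) 0.
  by rewrite enorm0 subr_ge0 bdist_le_inradius//; exact: Omega_closure.
have ev : 0 < enorm (x - m) by rewrite enorm_gt0.
(* [x + N (x - m)] is too far away to be in the domain *)
have [D hD] := Omega_enorm_bounded.
pose N := (`|D| + enorm x + 1) / enorm (x - m).
have N0 : 0 < N by rewrite divr_gt0// ltr_wpDl// addr_ge0// enorm_ge0.
have Oy : ~ Omega (x + N *: (x - m)).
  move=> /Omega_closure/hD h; have := enormD (x + N *: (x - m)) (- x).
  rewrite addrC addKr enormZ gtr0_norm// divfK ?lt0r_neq0// enormN.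
  have := ler_norm D; lra.
have [t [t0 t1]] := exit_point Ox Oy.
rewrite [_ - x]addrC addKr scalerA; set a := t * N.
have a0 : 0 < a by rewrite mulr_gt0.
set p := _ + _ => fp.
have pm : p - m = (1 + a) *: (x - m).
  by rewrite /p; apply/rowP => i; rewrite !mxE; ring.
have xp : enorm (x - p) = a * enorm (x - m).
  by rewrite /p opprD addrA subrr sub0r enormN enormZ gtr0_norm.
have [q Mq qp] := touching_ridge fp.
have pmq : enorm (p - m) <= enorm (q - p).
  rewrite enorm_leP ?enorm_ge0// enorm_sqr.
  have -> : q - p = (q - m) - (p - m) by apply/rowP => i; rewrite !mxE; ring.
  rewrite (dotBl (q - m)) !(dotBr (q - m)) (dotC (p - m) (q - m)).
  have a1 : 0 <= 1 + a by lra.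
  have : dot (q - m) (p - m) <= 0.
    by rewrite pm dotZr dotC mulr_ge0_le0// obt.
  have := dot_ge0 (q - m); move: (dot _ _) (dot _ _) (dot _ _) => ? ? ?; lra.
have := bdist_le x fp; rewrite xp.
have : enorm (p - m) = (1 + a) * enorm (x - m).
  by rewrite pm enormZ ger0_norm//; lra.
lra.
Qed.

Lemma solution_phiN x : K x -> u x = phiN Omega x.
Proof.
move=> Kx; rewrite /phiN.
have [Ox|fx] := closure_split Kx; last by rewrite u_frontier// bdist_frontier// subr0 subrr mulr0.
have dr := bdist_le_inradius Kx; have rho0 := inradius_gt0.
apply/eqP; rewrite eq_le; apply/andP; split.
  have [dlt|dge] := ltP (d x) rho.
    by have := frontier_upper_bound Ox; rewrite c_inradius => /(_ dlt); lra.
  have -> : d x = rho by apply/eqP; rewrite eq_le dr.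
  by have := half_sq_bound Kx; rewrite c_inradius subrr expr0n /=; lra.
have := ridge_distance_le Ox; have [Mm _] := ridge_projP x.
set m := proj M x in Mm *; set s := enorm (x - m) => sd.
have dx := bdist_gt0 Ox.
have dm : d m = rho by case: Mm.
have sm : s < d m by rewrite dm; lra.
have := paraboloid_below (ridge_Omega Mm) sm; rewrite dm -/s.
have : s ^+ 2 <= (rho - d x) ^+ 2.
  by rewrite ler_pXn2r// nnegrE ?subr_ge0// enorm_ge0.
lra.
Qed.

(** Off the ridge [d = rho - sqrt (rho^2 - 2 u)]; on the ridge [d] is maximal, yet
    decreases with slope one towards a nearest frontier point. *)
Lemma singular_ridge : singular_set Omega = M.
Proof.
apply/seteqP; split => x /=.
  move=> [Ox nd]; split; first exact: Omega_closure.
  apply/eqP; rewrite eq_le bdist_le_inradius/=; last exact: Omega_closure.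
  rewrite leNgt; apply/negP => dx; apply: nd.
  have uE y : Omega y -> rho ^+ 2 - 2 * u y = (rho - d y) ^+ 2.
    by move=> /Omega_closure/solution_phiN ->; rewrite /phiN; field.
  pose f y := rho - Num.sqrt (rho ^+ 2 - 2 * u y).
  apply: (@near_differentiable _ _ f).
    have d1 : differentiable (fun y => rho ^+ 2 - 2 * u y) x.
      apply: differentiableB; first exact: differentiable_cst.
      by apply: differentiableZ; exact: u_diff.
    apply: differentiableB; first exact: differentiable_cst.
    apply: (@differentiable_comp _ _ _ _ _ (@Num.sqrt R)) => //.
    apply/derivable1_diffP; apply: (@ex_derive _ _ _ _ _ _ _ (is_derive1_sqrt _)).
    by rewrite uE// exprn_gt0// subr_gt0.
  have [r r0 hr] := open_enormP Omega_open Ox.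
  exists r => // y /hr Oy; rewrite /f uE// sqrtr_sqr ger0_norm ?subr_ge0.
    by rewrite opprB addrC subrK.
  by apply: bdist_le_inradius; exact: Omega_closure.
move=> Mx; have Ox := ridge_Omega Mx; split=> // dd.
have [p fp ep] := bdist_attained x.
have := bdist_gradient dd fp ep; have dx := bdist_gt0 Ox.
have [r r0 hr] := open_segment (- (p - x)) Omega_open Ox.
have : dot (gradient d x) (- (p - x)) <= 0.
  apply: (@gradient_le _ _ _ _ _ _ 0 r) => // t t0 tr; rewrite !mul0r !addr0.
  case: Mx => _ ->; apply: bdist_le_inradius; apply: Omega_closure.
  by apply: hr; rewrite gtr0_norm.
rewrite dotNr; lra.
Qed.

End Solution.

Lemma overdetermined_rigidity (c : R) (u : 'rV[R]_n -> R) :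
  overdetermined_solution Omega c u ->
  [/\ forall x, K x -> u x = phiN Omega x, rho = c & cut_locus Omega = M].
Proof.
move=> [[_ usub usup] uf [g [cu du cg gu] gf]]; split.
- exact: (solution_phiN usub usup uf cu du cg gu gf).
- by rewrite (c_inradius usub usup uf cu du cg gu gf).
- rewrite /cut_locus (singular_ridge usub usup uf cu du cg gu gf).
  by apply/esym/closure_id; exact: ridge_closed.
Qed.

End Domain.
End ConvexDomain.

Theorem theorem3 (R : realType) (n : nat) (n_gt0 : (0 < n)%N)
    (Omega : set 'rV[R]_n)
    (Omega_neq0 : Omega !=set0) (Omega_open : open Omega)
    (Omega_bounded : bounded_set Omega) (Omega_connected : connected Omega)
    (Omega_convex : convex Omega) :
  ((exists (c : R) (u : 'rV[R]_n -> R), overdetermined_solution Omega c u)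
     <-> stadium_like Omega)
  /\ (forall (c : R) (u : 'rV[R]_n -> R), overdetermined_solution Omega c u ->
        (forall x, closure Omega x -> u x = phiN Omega x)
        /\ inradius Omega = c).
Proof.
have rigidity := overdetermined_rigidity n_gt0 Omega_neq0 Omega_open
  Omega_bounded Omega_convex.
split; last by move=> c u /rigidity[].
split=> [[c [u /rigidity[_ _ cutM]]]|[_ _ _ cutM]]; first by split.
exists (inradius Omega), (paraboloid (high_ridge Omega) (inradius Omega)).
exact: stadium_overdetermined.
Qed.
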